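(* Let $G$ be a finitely generated group equipped with a left-invariant total order $<$, and let $S\subseteq\{g\in G:g>1\}$ be a generating set of $G$ with $|S|\geq 2$. Let $f=m+\sum_{s\in S}a_s s\in\mathbb{Z}(G)$, where $m\in\mathbb{Z}$ and $a_s\in\mathbb{Z}$ (all but finitely many equal to $0$), and assume that $\sum_{s\in S}|a_s|<|m|$. Then $G\curvearrowright(X_f,m_{X_f})$ is a factor of a Bernoulli shift over $G$. If moreover $G$ is amenable, then $G\curvearrowright(X_f,m_{X_f})$ is isomorphic to a Bernoulli shift over $G$ with entropy $\log|m|$.
   Context: A left-invariant total order on $G$ is a total order $<$ such that $x<y$ implies $gx<gy$ for all $g,x,y\in G$. $\mathbb{Z}(G)$ is the integral group ring. For $f\in\mathbb{Z}(G)$, $X_f$ is the Pontryagin dual of the discrete abelian group $\mathbb{Z}(G)/\mathbb{Z}(G)f$, i.e. the compact abelian group of all homomorphisms $\mathbb{Z}(G)/\mathbb{Z}(G)f\to\mathbb{R}/\mathbb{Z}$, with Haar probability measure $m_{X_f}$; $G$ acts on $X_f$ by continuous automorphisms dual to left multiplication: $(g\chi)(a)=\chi(g^{-1}a)$. A Bernoulli shift over $G$ with base a probability space $(B,\beta)$ (a one-point base is allowed) is the action $G\curvearrowright(B^G,\beta^{\otimes G})$, $(gb)(h)=b(g^{-1}h)$; for amenable $G$ its entropy is the Shannon entropy of $(B,\beta)$. A probability measure-preserving action $G\curvearrowright(Y,\eta)$ is a factor of $G\curvearrowright(Z,\zeta)$ if there is an almost everywhere $G$-equivariant measurable map $\pi:Z\to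 Y$ with $\pi_*\zeta=\eta$; isomorphism means such a map that is injective modulo null sets. *)

(* Defs.v *)
From HB Require Import structures.
From mathcomp Require Import all_boot all_order all_algebra finmap.
From mathcomp Require Import all_classical all_reals all_analysis.

Set Implicit Arguments.
Unset Strict Implicit.
Unset Printing Implicit Defensive.

Import Order.TTheory GRing.Theory Num.Theory.
Import numFieldNormedType.Exports.

Local Open Scope classical_set_scope.
Local Open Scope ring_scope.

Section Groups.
Variable G : groupType.

Definition left_invariant_order (lt : rel G) : Prop :=
  [/\ irreflexive lt, transitive lt,
      (forall x y, x != y -> lt x y || lt y x) &
      (forall g x y, lt x y -> lt (g * x)%g (g * y)%g)].

Definition generates (S : set G) : Prop :=
  forall H : set G, S `<=` H -> H 1%g ->
    (forall x y, H x -> H y -> H (x * y)%g) ->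
    (forall x, H x -> H (x^-1)%g) -> H = setT.

Definition finitely_generated : Prop :=
  exists S : set G, finite_set S /\ generates S.

(* Folner's condition, for discrete groups *)
Definition amenable : Prop :=
  forall (K : {fset G}) (eps : rat), 0 < eps ->
    exists2 F : {fset G}, F != fset0 &
      forall g, g \in K ->
        let gF := [fset (g * h)%g | h in F]%fset in
        (#|` (gF `\` F) `|` (F `\` gF)|%fset)%:R <= eps * #|` F|%:R.

End Groups.

(* The integral group ring Z(G): finitely supported functions G -> Z under    *)
(* convolution.                                                               *)
Definition groupring (G : groupType) : Type := {fsfun G -> int with 0}.

HB.instance Definition _ (G : groupType) := Choice.on (groupring G).

Section GroupRing.
Variable G : groupType.
Implicit Types (x y z : groupring G) (g h k : G).

Definition gr_coef x : G -> int := fun g => (x : {fsfun G -> int with 0}) g.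

Definition gr_supp x : {fset G} := finsupp (x : {fsfun G -> int with 0}).

Lemma gr_ext x y : gr_coef x =1 gr_coef y -> x = y.
Proof. by move=> xy; apply/fsfunP. Qed.

Lemma gr_coef_out x g : g \notin gr_supp x -> gr_coef x g = 0.
Proof. exact: fsfun_dflt. Qed.

Definition gr_zero : groupring G := [fsfun].
Definition gr_opp x : groupring G := [fsfun g in gr_supp x => - gr_coef x g].
Definition gr_add x y : groupring G :=
  [fsfun g in (gr_supp x `|` gr_supp y)%fset => gr_coef x g + gr_coef y g].

Lemma gr_zeroE g : gr_coef gr_zero g = 0.
Proof. by rewrite /gr_coef fsfun0E. Qed.

Lemma gr_oppE x g : gr_coef (gr_opp x) g = - gr_coef x g.
Proof.
rewrite {1}/gr_coef fsfun_fun; case: ifPn => // /gr_coef_out ->.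
by rewrite oppr0.
Qed.

Lemma gr_addE x y g : gr_coef (gr_add x y) g = gr_coef x g + gr_coef y g.
Proof.
rewrite {1}/gr_coef fsfun_fun in_fsetU; case: ifPn => //.
by rewrite negb_or => /andP[/gr_coef_out -> /gr_coef_out ->]; rewrite addr0.
Qed.

Let gr_addA : associative gr_add.
Proof. by move=> x y z; apply: gr_ext => g; rewrite !gr_addE addrA. Qed.

Let gr_addC : commutative gr_add.
Proof. by move=> x y; apply: gr_ext => g; rewrite !gr_addE addrC. Qed.

Let gr_add0 : left_id gr_zero gr_add.
Proof. by move=> x; apply: gr_ext => g; rewrite gr_addE gr_zeroE add0r. Qed.

Let gr_addN : left_inverse gr_zero gr_opp gr_add.
Proof.
by move=> x; apply: gr_ext => g; rewrite gr_addE gr_oppE gr_zeroE addNr.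
Qed.

HB.instance Definition _ :=
  GRing.isZmodule.Build (groupring G) gr_addA gr_addC gr_add0 gr_addN.

Lemma gr_coef0 g : gr_coef 0 g = 0.
Proof. exact: gr_zeroE. Qed.

Lemma gr_coefD x y g : gr_coef (x + y) g = gr_coef x g + gr_coef y g.
Proof. exact: gr_addE. Qed.

Lemma gr_coefN x g : gr_coef (- x) g = - gr_coef x g.
Proof. exact: gr_oppE. Qed.

Definition gr_elt g : groupring G := [fsfun h in [fset g]%fset => 1%:Z].

Lemma gr_eltE g h : gr_coef (gr_elt g) h = (h == g)%:R.
Proof. by rewrite /gr_coef fsfun_fun in_fset1; case: eqP. Qed.

Definition gr_mul x y : groupring G :=
  [fsfun k in [fset (g * h)%g | g in gr_supp x, h in gr_supp y]%fset =>
     \sum_(g <- gr_supp x) gr_coef x g * gr_coef y (g^-1 * k)%g].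

Lemma gr_mulEw (D : {fset G}) x y k : (gr_supp x `<=` D)%fset ->
  gr_coef (gr_mul x y) k = \sum_(g <- D) gr_coef x g * gr_coef y (g^-1 * k)%g.
Proof.
move=> xD; transitivity
  (\sum_(g <- gr_supp x) gr_coef x g * gr_coef y (g^-1 * k)%g); last first.
  by apply: big_fset_incl => // g _ /gr_coef_out ->; rewrite mul0r.
rewrite {1}/gr_coef fsfun_fun; case: ifPn => // kxy.
rewrite big_seq big1// => g gx; rewrite [X in _ * X]gr_coef_out ?mulr0//.
apply: contra kxy => gky; apply/imfset2P; exists g => //.
by exists (g^-1 * k)%g => //; rewrite mulgA mulgV mul1g.
Qed.

Lemma gr_mulE x y k : gr_coef (gr_mul x y) k =
  \sum_(g <- gr_supp x) gr_coef x g * gr_coef y (g^-1 * k)%g.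
Proof. exact: gr_mulEw. Qed.

Lemma gr_supp_elt g : (gr_supp (gr_elt g) `<=` [fset g])%fset.
Proof.
apply/fsubsetP => h; rewrite in_fset1 mem_finsupp -[X in X != _]/(gr_coef _ _).
by rewrite gr_eltE; case: (h == g).
Qed.

Lemma gr_mul_eltl g y k : gr_coef (gr_mul (gr_elt g) y) k =
  gr_coef y (g^-1 * k)%g.
Proof.
by rewrite (gr_mulEw _ _ (gr_supp_elt g)) big_seq_fset1 gr_eltE eqxx mul1r.
Qed.

Let gr_mul1l : left_id (gr_elt 1%g) gr_mul.
Proof. by move=> x; apply: gr_ext => k; rewrite gr_mul_eltl invg1 mul1g. Qed.

Let gr_mul1r : right_id (gr_elt 1%g) gr_mul.
Proof.
move=> x; apply: gr_ext => k.
rewrite (@gr_mulEw (k |` gr_supp x)%fset) ?fsubsetU1//.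
rewrite (big_fsetD1 k) ?fset1U1//= gr_eltE mulVg eqxx mulr1 big1_fset ?addr0//.
move=> g; rewrite in_fsetD1 => /andP[gk _] _; rewrite gr_eltE.
case: eqP => [gk1|_]; last by rewrite mulr0.
by move: gk; rewrite -[g]mulg1 -gk1 mulgA mulgV mul1g eqxx.
Qed.

Let gr_mulDl : left_distributive gr_mul +%R.
Proof.
move=> x y z; apply: gr_ext => k; rewrite gr_coefD.
set D := (gr_supp x `|` gr_supp y)%fset.
have xyD : (gr_supp (x + y)%R `<=` D)%fset.
  apply/fsubsetP => g; apply: contraLR.
  rewrite [g \in D]in_fsetU negb_or.
  move=> /andP[gx gy]; rewrite memNfinsupp -[X in X == _]/(gr_coef _ _).
  by rewrite gr_coefD !gr_coef_out.
rewrite !(@gr_mulEw D) ?fsubsetUl ?fsubsetUr// -big_split.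
by apply: eq_bigr => g _; rewrite gr_coefD mulrDl.
Qed.

Let gr_mulDr : right_distributive gr_mul +%R.
Proof.
move=> x y z; apply: gr_ext => k; rewrite gr_coefD !gr_mulE -big_split.
by apply: eq_bigr => g _; rewrite gr_coefD mulrDr.
Qed.

Let gr_mulA : associative gr_mul.
Proof.
move=> x y z; apply: gr_ext => k.
set D := [fset (g * h)%g | g in gr_supp x, h in gr_supp y]%fset.
have xyD : (gr_supp (gr_mul x y) `<=` D)%fset by exact: finsupp_sub.
rewrite (gr_mulEw _ _ xyD) gr_mulE.
under [RHS]eq_bigr => u _ do rewrite gr_mulE mulr_suml.
rewrite exchange_big/= big_seq [RHS]big_seq; apply: eq_bigr => g gx.
under [RHS]eq_bigr => u _ do rewrite -mulrA.
rewrite -mulr_sumr; congr (_ * _); rewrite gr_mulE.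
pose E := [fset (g * h)%g | h in gr_supp y]%fset.
have ED : (E `<=` D)%fset.
  apply/fsubsetP => u /imfsetP[h /= hy ->]; apply/imfset2P.
  by exists g => //; exists h.
rewrite -(big_fset_incl _ ED)/=; last first.
  move=> u _ uE; rewrite gr_coef_out ?mul0r//; apply: contra uE => guy.
  by apply/imfsetP; exists (g^-1 * u)%g => //=; rewrite mulgA mulgV mul1g.
rewrite big_imfset/=; last by move=> h1 h2 _ _; exact: mulgI.
apply: eq_bigr => h _.
by rewrite mulKg invgM mulgA.
Qed.

Let gr_1neq0 : gr_elt 1%g != 0.
Proof.
apply/eqP => /(congr1 (fun x => gr_coef x 1%g)).
by rewrite gr_eltE gr_coef0 eqxx.
Qed.

HB.instance Definition _ := GRing.Zmodule_isNzRing.Build (groupring G)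
  gr_mulA gr_mul1l gr_mul1r gr_mulDl gr_mulDr gr_1neq0.

End GroupRing.

Section LeftIdeal.
Variables (G : groupType) (f : groupring G).

(* The principal left ideal Z(G)f *)
Definition lideal : pred (groupring G) :=
  fun x => `[< exists h : groupring G, x = h * f >].

Lemma lidealP x : reflect (exists h, x = h * f) (x \in lideal).
Proof. exact: asboolP. Qed.

Lemma lideal_zmod_closed : zmod_closed lideal.
Proof.
split=> [|x y /lidealP[h ->] /lidealP[k ->]].
  by apply/lidealP; exists 0; rewrite mul0r.
by apply/lidealP; exists (h - k); rewrite mulrBl.
Qed.

HB.instance Definition _ :=
  GRing.isZmodClosed.Build (groupring G) lideal lideal_zmod_closed.

Definition lideal_zmodClosed : zmodClosed (groupring G) :=
  GRing.ZmodClosed.clone (groupring G) lideal _.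

(* The left module Z(G)/Z(G)f, as an abelian group *)
Definition lquot : zmodType := Quotient.quot lideal_zmodClosed.

Local Open Scope quotient_scope.
Local Notation Q := (Quotient.quot lideal_zmodClosed).

Definition lquot_mul (g : G) (a : lquot) : lquot :=
  \pi_Q (gr_elt g * repr (a : Q)).

Lemma lquot_mul_pi g (x : groupring G) :
  lquot_mul g (\pi_Q x) = \pi_Q (gr_elt g * x).
Proof.
apply/eqP; rewrite /lquot_mul -Quotient.idealrBE -mulrBr.
have : (repr (\pi_Q x) - x) \in lideal_zmodClosed.
  by rewrite Quotient.idealrBE reprK.
move=> /lidealP[h ->]; apply/lidealP.
by exists (gr_elt g * h); rewrite mulrA.
Qed.

Lemma lquot_mul_zmod_morphism g : zmod_morphism (lquot_mul g).
Proof.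
move=> a b; rewrite -[a](@reprK _ Q) -[b](@reprK _ Q).
by rewrite -[X in lquot_mul _ X]raddfB !lquot_mul_pi mulrBr raddfB.
Qed.

HB.instance Definition _ g :=
  GRing.isZmodMorphism.Build lquot lquot (lquot_mul g)
    (lquot_mul_zmod_morphism g).

End LeftIdeal.

Definition int_zmodClosed (R : realType) : zmodClosed R :=
  GRing.ZmodClosed.clone R (@Num.int_num_subdef R) _.

(* R/Z with the quotient topology *)
Definition circle (R : realType) : Type :=
  quotient_topology (Quotient.quot (int_zmodClosed R)).

HB.instance Definition _ (R : realType) := Topological.on (circle R).
HB.instance Definition _ (R : realType) := GRing.isZmodule.Build (circle R)
  (@Quotient.addqA R (int_zmodClosed R)) (@Quotient.addqC R (int_zmodClosed R))
  (@Quotient.add0q R (int_zmodClosed R)) (@Quotient.addNq R (int_zmodClosed R)).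

(* The Pontryagin dual of the discrete abelian group A.  Since A is discrete, *)
(* the compact-open topology is the topology of pointwise convergence.        *)
Definition pontryagin_dual (R : realType) (A : zmodType) : Type :=
  {additive A -> circle R}.

HB.instance Definition _ (R : realType) (A : zmodType) :=
  gen_eqMixin (pontryagin_dual R A).
HB.instance Definition _ (R : realType) (A : zmodType) :=
  gen_choiceMixin (pontryagin_dual R A).

Section Dual.
Variables (R : realType) (A : zmodType).
Implicit Types chi psi : pontryagin_dual R A.

Definition dual_fun chi : {ptws A -> circle R} :=
  fun a => (chi : {additive A -> circle R}) a.

Lemma dual_ext chi psi : dual_fun chi =1 dual_fun psi -> chi = psi.
Proof.
move: chi psi => [u [[uM]]] [v [[vM]]] /funext uv.
have {}uv : u = v := uv.
by move: uM vM; rewrite uv => uM vM; rewrite (Prop_irrelevance uM vM).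
Qed.

Definition dual_zero : pontryagin_dual R A := (\0 : {additive A -> circle R}).
Definition dual_opp chi : pontryagin_dual R A :=
  (\- (chi : {additive A -> circle R}) : {additive A -> circle R}).
Definition dual_add chi psi : pontryagin_dual R A :=
  ((chi : {additive A -> circle R}) \+ (psi : {additive A -> circle R})
    : {additive A -> circle R}).

Let dual_addA : associative dual_add.
Proof. by move=> x y z; apply: dual_ext => a; exact: addrA. Qed.

Let dual_addC : commutative dual_add.
Proof. by move=> x y; apply: dual_ext => a; exact: addrC. Qed.

Let dual_add0 : left_id dual_zero dual_add.
Proof. by move=> x; apply: dual_ext => a; exact: add0r. Qed.

Let dual_addN : left_inverse dual_zero dual_opp dual_add.
Proof. by move=> x; apply: dual_ext => a; exact: addNr. Qed.

HB.instance Definition _ := GRing.isZmodule.Build (pontryagin_dual R A)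
  dual_addA dual_addC dual_add0 dual_addN.

HB.instance Definition _ :=
  isPointed.Build (pontryagin_dual R A) (0 : pontryagin_dual R A).

Definition dual_top : topologicalType := initial_topology dual_fun.

Definition dual_borel := g_sigma_algebraType (@open dual_top).

HB.instance Definition _ := Measurable.on dual_borel.

End Dual.

(* On X_f, which is compact and metrizable, every Borel probability measure   *)
(* is regular, so invariance characterizes the Haar probability measure.      *)
Definition is_haar (R : realType) (A : zmodType)
    (mu : probability (dual_borel R A) R) : Prop :=
  forall (chi : pontryagin_dual R A) (E : set (dual_borel R A)), measurable E ->
    mu [set (chi + psi : pontryagin_dual R A) | psi in E] = mu E.

Section AlgebraicAction.
Variables (R : realType) (G : groupType) (f : groupring G).

Definition Xf := dual_borel R (lquot f).

Definition Xf_act (g : G) (chi : Xf) : Xf :=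
  ((chi : {additive lquot f -> circle R}) \o lquot_mul g^-1%g
    : {additive lquot f -> circle R}).

End AlgebraicAction.

Section Bernoulli.
Variables (R : realType) (G : groupType).
Variables (d : measure_display) (B : measurableType d).

Definition cylinders : set (set (G -> B)) :=
  [set E | exists g (C : set B), measurable C /\ E = [set b | C (b g)]].

Definition shift_space := g_sigma_algebraType cylinders.

HB.instance Definition _ := Measurable.on shift_space.

Definition bernoulli_shift (g : G) (b : shift_space) : shift_space :=
  fun h => b (g^-1 * h)%g.

Definition is_product_measure (beta : probability B R)
    (zeta : probability shift_space R) : Prop :=
  forall (D : {fset G}) (C : G -> set B), (forall g, measurable (C g)) ->
    zeta [set b | forall g, g \in D -> C g (b g)] =
    (\prod_(g <- D) beta (C g))%E.

(* Standard Borel spaces, as the spaces Borel isomorphic to a Borel subset of *)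
(* the real line.                                                             *)
Definition standard_borel : Prop :=
  exists phi : B -> R, [/\ measurable_fun setT phi, injective phi &
    forall E : set B, measurable E -> measurable (phi @` E)].

(* Shannon entropy (natural logarithm) of a probability measure on a standard *)
(* Borel space; +oo unless the measure is concentrated on a countable set.    *)
(* The library's ln satisfies ln 0 = 0.                                       *)
Definition shannon_entropy (beta : probability B R) : \bar R :=
  if `[< exists C : set B, [/\ countable C, measurable C & beta C = 1%E] >]
  then \esum_(b in [set: B])
         (- (fine (beta [set b]) * ln (fine (beta [set b]))))%:E
  else +oo%E.

End Bernoulli.

Section Factors.
Variables (R : realType) (G : groupType).
Variables (d1 d2 : measure_display).
Variables (Z : measurableType d1) (Y : measurableType d2).
Variables (actZ : G -> Z -> Z) (zeta : probability Z R).
Variables (actY : G -> Y -> Y) (eta : probability Y R).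

Definition factor_map (pi : Z -> Y) : Prop :=
  [/\ measurable_fun setT pi,
      {ae zeta, forall z, forall g, pi (actZ g z) = actY g (pi z)} &
      forall E, measurable E -> pushforward zeta pi E = eta E].

Definition is_factor : Prop := exists pi : Z -> Y, factor_map pi.

(* When Z and Y are standard Borel, such a map automatically has a measurable *)
(* inverse off null sets (Lusin-Souslin).                                     *)
Definition isomorphic_actions : Prop :=
  exists2 pi : Z -> Y, factor_map pi &
    exists2 N : set Z, zeta.-negligible N &
      forall x y, ~ N x -> ~ N y -> pi x = pi y -> x = y.

End Factors.

(* Main.v *)
(** Put M = |m|, let T be the support of the a_s and multiply f by the sign of
    m.  A bounded real function v on G has exactly one bounded solution y of
    M y(g) + sum_(s in T) a_s y(gs) = v(g), because sum |a_s| < M; reducing y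
    modulo 1 gives an equivariant map xi from bounded integer functions on G
    onto X_f.  We show that xi restricted to {0, ..., M-1}^G, with the uniform
    product measure, is an isomorphism onto (X_f, Haar).

    Everything rests on the carries: if b + w (b a digit configuration, w a
    bounded integer function) and a digit configuration b' have the same image,
    their difference comes from an integer function c with
      c(g) = floor ((b(g) + w(g) - sum a_s c(gs)) / M),
    and b'(g) is the corresponding remainder.  Running this recursion from the
    extreme values K and -K gives nested bounds U_k(g), L_k(g) on c(g) which
    depend only on the digits at places >= g, since s > 1.  In the recursion
    the digit at g is independent of the carries from the places gs, and
    sum_(j < M) floor ((j + z) / M) = z for integers z, so
    E (U_(k+1) - L_(k+1)) <= (sum |a_s| / M) sup E (U_k - L_k).  Hence the
    carries are almost surely unique.

    With w = 0 this is almost sure injectivity of xi.  For general w the map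
    b |-> b' is triangular for the order of G, so it preserves the product
    measure; as xi(b') = xi(b) + xi(w), the image measure is translation
    invariant, hence equal to Haar measure. *)

Require Import Defs.
From HB Require Import structures.
From mathcomp Require Import all_boot all_order all_algebra finmap.
From mathcomp Require Import all_classical all_reals all_analysis.
From mathcomp Require Import measurable_realfun.
From mathcomp Require Import ring lra zify.

Set Implicit Arguments.
Unset Strict Implicit.
Unset Printing Implicit Defensive.

Import Order.TTheory GRing.Theory Num.Theory.
Import numFieldNormedType.Exports.

Local Open Scope classical_set_scope.
Local Open Scope ring_scope.

(** * Carries *)

(** Passing from [z] to [z + 1] moves the term at [k = 0] to [k = M], where it is larger by one. So
    both sides grow by one at each step, and they agree at [0]. *)
Lemma sum_divz (M : nat) (z : int) : (0 < M)%N ->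
  \sum_(k < M) divz (k%:Z + z) M = z.
Proof.
move=> M0; pose S z := \sum_(k < M) divz (k%:Z + z) M.
have SS y : S (y + 1) = S y + 1.
  case: M M0 @S => // M _ S; rewrite /S big_ord_recr big_ord_recl /=.
  rewrite (_ : M%:Z + (y + 1) = 1 * M.+1%:Z + (0 + y)); last lia.
  rewrite divzMDl// [1 + _]addrC addrA; congr (_ + 1); rewrite addrC; congr (_ + _).
  by apply: eq_bigr => i _; rewrite /bump /=; congr (divz _ _); lia.
have S0 : S 0 = 0.
  by rewrite /S big1// => i _; rewrite addr0 divz_small//= ltz_nat ltn_ord.
have Sn (n : nat) : S n = n.
  by elim: n => // n IH; rewrite -addn1 PoszD SS IH.
have SNn (n : nat) : S (- n%:Z) = - n%:Z.
  elim: n => [|n IH]; first by rewrite oppr0.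
  have := SS (- n.+1%:Z); rewrite (_ : _ + 1 = - n%:Z) ?IH; last lia.
  by move=> e; apply: (addIr 1); rewrite -e; lia.
by rewrite -/(S z); case: (intP z) => // n; rewrite ?Sn ?SNn.
Qed.

(** The default [0] makes carries total functions of the configuration; it is used only where the
    bounds never meet. *)
Definition first_agreement (u : nat -> bool -> int) : int :=
  if pselect (exists n, u n true == u n false) is left h
  then u (ex_minn h) true else 0.

Section Carry.
Variables (G : groupType) (ss : seq G) (al : G -> int) (M : nat).
Hypothesis M0 : (0 < M)%N.
Hypothesis alM : \sum_(s <- ss) `|al s| < M%:Z.

(** The ring is left open because the same sum acts on integer carries and on real solutions. *)
Definition shift_sum (V : pzRingType) (c : G -> V) (g : G) : V :=
  \sum_(s <- ss) c (g * s)%g *~ al s.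

(** The flag selects the upper or the lower end of an interval. The sum is subtracted, so for
    [al s >= 0] the upper end of the quotient calls for the lower end of the entering carry, and for
    [al s < 0] for the upper one; [b (+) (0 <= al s)] makes this switch. *)
Definition carry_step (x : G -> int) (F : bool -> G -> int) (b : bool) (g : G) :=
  divz (x g - \sum_(s <- ss) F (b (+) (0 <= al s)) (g * s)%g *~ al s) M.

Definition is_carry (x c : G -> int) :=
  forall g, c g = divz (x g - shift_sum c g) M.

(* [carry_bound x K n true] and [carry_bound x K n false] are the best upper  *)
(* and lower bounds at depth [n] on a carry with values in [-K, K].           *)
Fixpoint carry_bound (x : G -> int) (K : int) (n : nat) : bool -> G -> int :=
  if n is n'.+1 then carry_step x (carry_bound x K n')
  else fun b _ => if b then K else - K.

(** [F] is read as the interval from [F false] to [F true]; an exact function [c] is the degenerate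
    interval [fun=> c]. *)
Definition encl (F F' : bool -> G -> int) :=
  forall g, F' false g <= F false g /\ F true g <= F' true g.

Lemma carry_step_encl x F F' : encl F F' -> encl (carry_step x F) (carry_step x F').
Proof.
move=> FF g; split; apply: lez_pdiv2r => //; rewrite lerD2l lerN2;
  apply: ler_sum => s _; case: (leP 0 (al s)) => h //=;
  have [h1 h2] := FF (g * s)%g.
- exact: ler_wpMz2r.
- by rewrite ler_wnMz2r// ltW.
- exact: ler_wpMz2r.
- by rewrite ler_wnMz2r// ltW.
Qed.

Lemma carry_step_cst x c : carry_step x (fun=> c) = fun=> fun g => divz (x g - shift_sum c g) M.
Proof. by []. Qed.

Variables (x : G -> int) (K : int).

(** A carry is a fixed point of [carry_step], which preserves enclosure; the induction starts from
    [[-K, K]]. *)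
Lemma carry_bound_carry c n : is_carry x c -> (forall g, `|c g| <= K) ->
  encl (fun=> c) (carry_bound x K n).
Proof.
move=> xc cK; elim: n => [|n IH] /=.
  by move=> g; have := cK g; rewrite ler_norml => /andP[].
suff -> : (fun=> c) = carry_step x (fun=> c) by exact: carry_step_encl.
by rewrite carry_step_cst; apply/funext => b; apply/funext => g; rewrite {1}xc.
Qed.

Hypothesis xK : forall g, `|x g| <= K.

(** By integrality the coefficients have total size at most [M - 1], so the entering carries
    contribute at most [K * (M - 1)]. With [|x g| <= K] the dividend stays within [K * M]. *)
Lemma carry_bound0 : encl (carry_bound x K 1) (carry_bound x K 0).
Proof.
have K0 : 0 <= K by apply: le_trans (xK 1%g).
move=> g; rewrite /= /carry_step.
have H b : `|\sum_(s <- ss) (if b (+) (0 <= al s) then K else - K) *~ al s| <=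
    K * (M%:Z - 1).
  apply: (le_trans (ler_norm_sum _ _ _)).
  apply: (@le_trans _ _ (\sum_(s <- ss) K * `|al s|)).
    apply: ler_sum => s _; rewrite -mulrzr normrM intz ler_wpM2r//.
    by case: ifP => _; rewrite ?normrN ger0_norm.
  by rewrite -mulr_sumr ler_wpM2l// -ltzD1 subrK.
have := H true; have := H false; have := xK g; rewrite !ler_norml.
move=> /andP[x1 x2] /andP[f1 f2] /andP[t1 t2]; split.
- rewrite lez_divRL//; nia.
- apply: (@le_trans _ _ (divz (K * M) M)); last by rewrite mulzK//; lia.
  by apply: lez_pdiv2r => //; nia.
Qed.

Lemma carry_bound_nested n : encl (carry_bound x K n.+1) (carry_bound x K n).
Proof. by elim: n => [|n IH]; [exact: carry_bound0|exact: carry_step_encl]. Qed.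

Lemma carry_bound_homo n n' : (n <= n')%N ->
  encl (carry_bound x K n') (carry_bound x K n).
Proof.
move=> /subnK <-; elim: (n' - n)%N => [g|k IH g]; first by [].
have [h1 h2] := IH g; have [h3 h4] := carry_bound_nested (k + n) g.
by rewrite addSn; split; [exact: le_trans h3|exact: le_trans h2].
Qed.

(** An exact function inside the interval is carried through the recursion: it starts as [0], and
    each step sends it to an exact function inside the next interval. *)
Lemma carry_bound_le n g : carry_bound x K n false g <= carry_bound x K n true g.
Proof.
have K0 : 0 <= K by apply: le_trans (xK 1%g).
have [c] : exists c, encl (fun=> c) (carry_bound x K n).
  elim: n => [|n [c IH]]; first by exists (fun=> 0) => h /=; rewrite oppr_le0.
  by eexists; exact: carry_step_encl IH.
by move=> /(_ g)[]; exact: le_trans.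
Qed.

Definition carry_good := forall g, exists n,
  carry_bound x K n true g == carry_bound x K n false g.

Definition carry (g : G) : int :=
  first_agreement (fun n b => carry_bound x K n b g).

(** The bounds are nested and ordered, so their common value never changes once they have met; the
    first meeting depth gives the same value as any other. *)
Lemma carryE n g : carry_bound x K n true g == carry_bound x K n false g ->
  carry g = carry_bound x K n true g.
Proof.
move=> e; rewrite /carry /first_agreement; case: pselect => [h|]; last by case; exists n.
case: ex_minnP => k ek kn; have {}kn := kn _ e.
have [h1 h2] := carry_bound_homo kn g.
apply/eqP; rewrite eq_le h2 andbT (eqP ek) (le_trans h1)//.
exact: carry_bound_le.
Qed.

Lemma carry_bound_near g : (exists n,
    carry_bound x K n true g == carry_bound x K n false g) ->
  exists n, forall k, (n <= k)%N -> forall b, carry_bound x K k b g = carry g.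
Proof.
move=> [n e]; exists n => k nk b; rewrite (carryE e).
have [h1 h2] := carry_bound_homo nk g; have h3 := carry_bound_le k g.
move: h1 h2; rewrite (eqP e) => h1 h2.
have et : carry_bound x K k true g = carry_bound x K n false g.
  by apply/eqP; rewrite eq_le h2 (le_trans h1).
have ef : carry_bound x K k false g = carry_bound x K n false g.
  by apply/eqP; rewrite eq_le h1 andbT (le_trans h3).
by case: b.
Qed.

Lemma carry_is_carry : carry_good -> is_carry x carry.
Proof.
move=> good g.
have {}good h := carry_bound_near (good h).
(* As [ss] is finite, one depth serves for all the places [g * s]; one more step of the recursion
   then reads off the carry equation at [g]. *)
have [n Hn] : exists n, forall k, (n <= k)%N -> forall b,
    all (fun s => carry_bound x K k b (g * s)%g == carry (g * s)%g) ss.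
  elim: ss => [|s r [n IH]]; first by exists 0.
  have [n' Hn'] := good (g * s)%g.
  exists (maxn n n') => k; rewrite geq_max => /andP[nk nk'] b /=.
  by rewrite Hn'// eqxx IH.
have [n' Hn'] := good g; rewrite -(Hn' (maxn n n').+1 _ true)/=; last first.
  by rewrite leqW// leq_maxr.
rewrite /carry_step; congr (divz (_ - _) _).
rewrite /shift_sum big_seq [RHS]big_seq; apply: eq_bigr => s sS.
by congr (_ *~ _); apply/eqP; apply: (allP (Hn (maxn n n') (leq_maxl _ _) _)).
Qed.

(** A carry within [[-K, K]] is squeezed between the bounds, and these meet at every place. *)
Lemma carry_unique c : carry_good -> is_carry x c -> (forall g, `|c g| <= K) ->
  c = carry.
Proof.
move=> good xc cK; apply/funext => g; have [n e] := good g.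
have [h1 h2] := carry_bound_carry n xc cK g.
rewrite (carryE e); apply/eqP; rewrite eq_le h2/=.
by rewrite (eqP e).
Qed.

Lemma carry_le g : `|carry g| <= K.
Proof.
have K0 : 0 <= K by apply: le_trans (xK 1%g).
rewrite /carry /first_agreement; case: pselect => [h|]; last by rewrite normr0.
case: ex_minnP => k ek _; have [h1 h2] := carry_bound_homo (leq0n k) g.
by rewrite ler_norml h2 (eqP ek) h1.
Qed.

End Carry.

(** * Uniform digits *)

Section CountableValued.
Variables (d : measure_display) (T : measurableType d) (D : countType).

(** Measurability for the discrete sigma-algebra on a countable target, phrased by preimages so that
    [int], [bool] and pairs can serve as targets directly. *)
Definition preim_measurable (F : T -> D) :=
  forall Y : set D, measurable (F @^-1` Y).

Lemma preim_measurableP (F : T -> D) :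
  (forall y, measurable (F @^-1` [set y])) -> preim_measurable F.
Proof.
move=> mF Y; rewrite (_ : _ @^-1` _ =
    \bigcup_y (if `[< Y y >] then F @^-1` [set y] else set0)).
  apply: countable_bigcupT_measurable; first exact: countableP.
  by move=> y; case: asboolP.
apply/seteqP; split => t /=.
  by move=> Yt; exists (F t) => //; case: asboolP.
by move=> [y _]; case: asboolP => // Yy /= ->.
Qed.

End CountableValued.

Lemma preim_measurable_comp d (T : measurableType d) (D D' : countType)
    (F : T -> D) (h : D -> D') :
  preim_measurable F -> preim_measurable (h \o F).
Proof. by move=> mF Y; rewrite comp_preimage; exact: mF. Qed.

Lemma preim_measurable_pair d (T : measurableType d) (D D' : countType)
    (F : T -> D) (F' : T -> D') :
  preim_measurable F -> preim_measurable F' ->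
  preim_measurable (fun t => (F t, F' t)).
Proof.
move=> mF mF'; apply: preim_measurableP => -[y y'].
rewrite (_ : _ @^-1` _ = F @^-1` [set y] `&` F' @^-1` [set y']).
  exact: measurableI.
by apply/seteqP; split => t /= [-> ->].
Qed.

Lemma preim_measurable2 d (T : measurableType d) (D D' D2 : countType)
    (F : T -> D) (F' : T -> D') (h : D -> D' -> D2) :
  preim_measurable F -> preim_measurable F' ->
  preim_measurable (fun t => h (F t) (F' t)).
Proof.
move=> mF mF'.
exact: (preim_measurable_comp (fun p => h p.1 p.2) (preim_measurable_pair mF mF')).
Qed.

Lemma preim_measurable_sum d (T : measurableType d) (I : Type) (r : seq I)
    (F : I -> T -> int) :
  (forall i, preim_measurable (F i)) ->
  preim_measurable (fun t => \sum_(i <- r) F i t).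
Proof.
move=> mF; elim: r => [|i r IH] Y.
  rewrite (_ : _ @^-1` _ = if `[< Y 0 >] then setT else set0).
    by case: ifP.
  by apply/seteqP; split => t /=; rewrite big_nil; case: asboolP.
rewrite (_ : (fun t => _) = fun t => F i t + \sum_(j <- r) F j t).
  by apply: (preim_measurable2 +%R).
by apply/funext => t; rewrite big_cons.
Qed.

Lemma preim_measurable_fun d d' (T : measurableType d) (D : countType)
    (U : measurableType d') (F : T -> D) (h : D -> U) :
  preim_measurable F -> measurable_fun setT (fun t => h (F t)).
Proof.
move=> mF _ Y _; rewrite setTI (_ : _ @^-1` _ = F @^-1` (h @^-1` Y)) //.
Qed.

Lemma floor_preim_measurable (R : realType) :
  preim_measurable (Num.floor : measurableTypeR R -> int).
Proof.
apply: preim_measurableP => j.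
rewrite (_ : _ @^-1` _ = `[j%:~R, (j + 1)%:~R[%classic)//.
apply/seteqP; split => x /=.
  by move=> <-; rewrite in_itv/= floor_itv.
by rewrite in_itv/= => h; apply: floor_def.
Qed.

Definition digit (n : nat) : Type := 'I_n.+1.
HB.instance Definition _ n := Countable.on (digit n).
HB.instance Definition _ n := Finite.on (digit n).
HB.instance Definition _ n := isPointed.Build (digit n) (ord0 : 'I_n.+1).
HB.instance Definition _ n := @isMeasurable.Build default_measure_display
  (digit n) discrete_measurable discrete_measurable0
  discrete_measurableC discrete_measurableU.

Section Uniform.
Variables (R : realType) (n : nat).

(** Written as a scaled sum of Dirac masses, so that the measure axioms are inherited. *)
Definition uniform_digit : set (digit n) -> \bar R :=
  mscale (n.+1%:R^-1)%:nng
    (msum (fun k => \d_(inord k : digit n)) n.+1).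

HB.instance Definition _ := Measure.on uniform_digit.

Lemma uniform_digitE (C : set (digit n)) :
  uniform_digit C = (n.+1%:R^-1 * \sum_(k : digit n) (k \in C)%:R)%:E.
Proof.
rewrite /uniform_digit /mscale /msum EFinM -sumEFin; congr (_ * _)%E.
by apply: eq_bigr => k _; rewrite /= diracE inord_val.
Qed.

Lemma uniform_digitT : uniform_digit setT = 1%E.
Proof.
rewrite uniform_digitE.
under eq_bigr => k _ do rewrite in_setT.
by rewrite sumr_const card_ord mulVf.
Qed.

HB.instance Definition _ :=
  Measure_isProbability.Build _ _ _ uniform_digit uniform_digitT.

Lemma digit_standard_borel : standard_borel R (digit n).
Proof.
exists (fun k : digit n => (k : nat)%:R); split=> //.
- by move=> k k' /= /eqP; rewrite eqr_nat => /eqP h; apply: val_inj.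
- move=> E _; apply: countable_measurable => //.
  by apply: finite_set_countable; apply: finite_image; exact: finite_finset.
Qed.

Lemma uniform_digit1 k : uniform_digit [set k] = (n.+1%:R^-1)%:E.
Proof.
rewrite uniform_digitE (bigD1 k)//= big1 => [|j /negPf jk].
  by rewrite classical_sets.in_set1 eqxx addr0 mulr1.
by rewrite classical_sets.in_set1 jk.
Qed.

Lemma uniform_digit_entropy :
  shannon_entropy (uniform_digit : probability _ R) = (ln n.+1%:R)%:E.
Proof.
rewrite /shannon_entropy ifT; last first.
  apply/asboolP; exists setT; split => //.
    exact/finite_set_countable/finite_finset.
  exact: probability_setT.
have E (k : digit n) : - (fine (uniform_digit [set k]) *
    ln (fine (uniform_digit [set k]))) = n.+1%:R^-1 * ln n.+1%:R.
  by rewrite uniform_digit1/= lnV ?posrE// mulrN opprK.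
rewrite esum_fset; last 2 first.
- exact: finite_finset.
- by move=> k _; rewrite lee_fin E mulr_ge0// ln_ge0// ler1n.
rewrite (_ : setT = [set` enum {: digit n}]); last first.
  by apply/seteqP; split => k //= _; rewrite mem_enum.
rewrite -fsbig_seq ?enum_uniq// big_enum/=; under eq_bigr => k _ do rewrite E.
by rewrite sumEFin sumr_const card_ord -[X in X%:E]mulr_natl mulrA divff// mul1r.
Qed.

End Uniform.

Section PushforwardMeasure.
Context d d' (T : measurableType d) (T' : measurableType d') (R : realType).
Variables (m : {measure set T -> \bar R}) (f : T -> T').
Hypothesis mf : measurable_fun setT f.

Definition pushforward_measure : {measure set T' -> \bar R} :=
  @measure_function_pushforward__canonical__measure_function_Measure
    _ _ _ _ _ m f mf.

End PushforwardMeasure.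

Section PushforwardProbability.
Context d d' (T : measurableType d) (T' : measurableType d') (R : realType).
Variables (m : probability T R) (f : T -> T').
Hypothesis mf : measurable_fun setT f.

Definition push_prob : set T' -> \bar R := pushforward m f.

HB.instance Definition _ := Measure.copy push_prob (pushforward_measure m mf).

Lemma push_probT : push_prob setT = 1%E.
Proof. by rewrite /push_prob /pushforward preimage_setT probability_setT. Qed.

HB.instance Definition _ := Measure_isProbability.Build _ _ _ push_prob push_probT.

Definition pushforward_probability : probability T' R := push_prob.

Lemma pushforward_probabilityE A : pushforward_probability A = m (f @^-1` A).
Proof. by []. Qed.

End PushforwardProbability.

(** * Base [n.+1] digits of a Lebesgue-random point of [[0, 1)] *)

Section Digits.
Variables (R : realType) (n : nat).
Local Notation T := (measurableTypeR R).
Local Notation M := (n.+1%:R : R).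

(** The affine branch of the digit shift on the interval where the first digit is [k]. *)
Definition dilate (k : nat) (x : T) : T := M * x - k%:R.

Lemma measurable_dilate k : measurable_fun setT (dilate k).
Proof. by apply: measurable_funB => //; exact: measurable_funM. Qed.

Lemma lebesgue_dilate k (E : set T) : measurable E ->
  lebesgue_measure (dilate k @^-1` E) = (M^-1%:E * lebesgue_measure E)%E.
Proof.
move=> mE.
have M0 : 0 < M by [].
(* [M] times the image of Lebesgue measure agrees with Lebesgue measure on half-open intervals,
   hence on all Borel sets. *)
pose m : {measure set T -> \bar R} :=
  mscale (NngNum (ler0n R n.+1)) (pushforward_measure lebesgue_measure (measurable_dilate k)).
have -> : lebesgue_measure E = m E.
  apply: (@lebesgue_measure_unique R m) mE => _ [[a b] _ <-] /=.
  rewrite /m /mscale/= /pushforward.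
  have -> : dilate k @^-1` `]a, b]%classic =
      `](a + k%:R) / M, (b + k%:R) / M]%classic.
    apply/seteqP; split => x /=; rewrite /dilate !in_itv/=;
      by rewrite ltr_pdivrMr// ler_pdivlMr// ltrBrDr lerBlDr mulrC.
  rewrite lebesgue_measure_itv/= lebesgue_measure_itv/= !lte_fin ltr_pM2r ?invr_gt0// ltrD2r.
  case: ifP => _; last by rewrite mule0.
  by rewrite -!EFinB -EFinM; congr (_%:E); field.
by rewrite /m /mscale/= muleA -EFinM mulVf// mul1e.
Qed.

Definition unit_measure : set T -> \bar R := mrestr lebesgue_measure (measurable_itv `[0, 1[).

HB.instance Definition _ := Measure.on unit_measure.

Lemma unit_measureT : unit_measure setT = 1%E.
Proof.
rewrite /unit_measure /mrestr setTI lebesgue_measure_itv/= lte_fin ltr01.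
by rewrite oppr0 adde0.
Qed.

HB.instance Definition _ :=
  Measure_isProbability.Build _ _ _ unit_measure unit_measureT.

(** Leading digit and tail of the base [n.+1] expansion. Values off [[0, 1)] are arbitrary;
    [unit_measure] does not see them. *)
Definition first_digit (x : T) : digit n := inord `|Num.floor (M * x)|.
Definition next_digits (x : T) : T := M * x - (Num.floor (M * x))%:~R.

Lemma measurable_floor_dilate : preim_measurable (fun x : T => Num.floor (M * x)).
Proof.
move=> Y; have mM : measurable_fun setT (fun x : T => M * x).
  exact: measurable_funM.
by have := mM measurableT _ (floor_preim_measurable Y); rewrite setTI.
Qed.

Lemma measurable_first_digit (C : set (digit n)) : measurable (first_digit @^-1` C).
Proof.
exact: (preim_measurable_comp (fun j : int => inord `|j|%N : digit n) measurable_floor_dilate).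
Qed.

Lemma measurable_next_digits : measurable_fun setT next_digits.
Proof.
apply: measurable_funB; first exact: measurable_funM.
exact: preim_measurable_fun measurable_floor_dilate.
Qed.

(** Where the first digit is [k], the tail map is [dilate k] and carries that piece onto [[0, 1)].
    Each piece thus contributes [M^-1] times the measure of [E], and the pieces with [k] in [C] are
    added up. *)
Lemma first_digit_indep (C : set (digit n)) (E : set T) : measurable E ->
  unit_measure (first_digit @^-1` C `&` next_digits @^-1` E) =
  (uniform_digit R C * unit_measure E)%E.
Proof.
move=> mE; pose E' := E `&` `[0, 1[%classic.
have mE' : measurable E' by exact: measurableI.
have Ek (k : digit n) : unit_measure (first_digit @^-1` [set k] `&` next_digits @^-1` E) =
    (M^-1%:E * unit_measure E)%E.
  rewrite /unit_measure/= /mrestr -(lebesgue_dilate k)//.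
  congr lebesgue_measure; apply/seteqP; split => x /=.
  - move=> [[<- Ex]]; rewrite /= in_itv/= => /andP[x0 x1].
    have Mx0 : 0 <= M * x by rewrite mulr_ge0.
    have f0 : 0 <= Num.floor (M * x) by rewrite floor_ge0.
    have e : (first_digit x)%:R = (Num.floor (M * x))%:~R :> R.
      rewrite /first_digit inordK ?natr_absz ?ger0_norm//.
      rewrite -ltz_nat gez0_abs// -(ltr_int R).
      by rewrite (le_lt_trans (floor_le _))// gtr_pMr.
    rewrite /dilate e; split; first exact: Ex.
    have /andP[h1 h2] := floor_itv (M * x).
    by rewrite in_itv/= subr_ge0 h1/= ltrBlDr addrC -intrD1.
  - rewrite !in_itv/= /dilate => -[Ex /andP[h1 h2]].
    have e : Num.floor (M * x) = k%:Z.
      apply: floor_def; rewrite -subr_ge0 h1/=.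
      by rewrite intrD1 addrC -ltrBlDr.
    split; first split.
    + by rewrite /first_digit e absz_nat inord_val.
    + by rewrite /next_digits e.
    + rewrite -(pmulr_rge0 _ (ltr0Sn R n)) -(ltr_pM2l (ltr0Sn R n)) mulr1.
      apply/andP; split.
        by rewrite (@le_trans _ _ k%:R)// -subr_ge0.
      have : (k.+1%:R : R) <= M by rewrite ler_nat ltn_ord.
      rewrite -natr1; lra.
rewrite (_ : _ `&` _ = \big[setU/set0]_(k : digit n)
   (if k \in C then first_digit @^-1` [set k] `&` next_digits @^-1` E else set0)).
  have mA (k : digit n) : measurable
      (if k \in C then first_digit @^-1` [set k] `&` next_digits @^-1` E else set0).
    case: ifP => // _; apply: measurableI; first exact: measurable_first_digit.
    by rewrite -[X in measurable X]setTI; exact: measurable_next_digits.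
  rewrite measure_bigsetU_ord//; last first.
    move=> k k' _ _ [x []]; do 2 case: ifP => // _.
    by move=> [/= -> _] [].
  rewrite uniform_digitE EFinM -muleA -sumEFin.
  rewrite (eq_bigr (fun k : digit n => (M^-1%:E * ((k \in C)%:R%:E * unit_measure E))%E)).
    rewrite -ge0_sume_distrr; last by move=> k _; rewrite mule_ge0// lee_fin.
    by rewrite -ge0_sume_distrl// => k _; rewrite lee_fin.
  move=> k _; case: ifP => _; first by rewrite mul1e; exact: Ek.
  by rewrite mul0e mule0; exact: measure0.
apply/seteqP; split => x.
  move=> [/= Cx Ex]; rewrite (bigD1 (first_digit x))//= mem_set//; left; split => //.
elim/big_ind: _ => //= [A B hA hB [] //|k _].
by case: ifPn => // /set_mem Ck [/= -> Ex].
Qed.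

Definition nth_digit (i : nat) (x : T) : digit n := first_digit (iter i next_digits x).

Lemma measurable_digits N (C : nat -> set (digit n)) :
  measurable [set x : T | forall i, (i < N)%N -> C i (nth_digit i x)].
Proof.
rewrite (_ : [set _ | _] = \bigcap_(i in [set i | (i < N)%N]) (nth_digit i @^-1` C i)).
  apply: bigcap_measurableType => i _.
  elim: i (C i) => [|i IH] Ci; first exact: measurable_first_digit.
  have := measurable_next_digits measurableT (IH Ci); rewrite setTI.
  by congr measurable; apply/seteqP; split => x /=; rewrite /nth_digit iterSr.
by apply/seteqP; split => x /=.
Qed.

(** The first digit is split off; the remaining conditions form the same event for the tail, with
    [C] shifted by one. *)
Lemma digits_indep N (C : nat -> set (digit n)) :
  unit_measure [set x : T | forall i, (i < N)%N -> C i (nth_digit i x)] =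
  (\prod_(i < N) uniform_digit R (C i))%E.
Proof.
elim: N C => [|N IH] C.
  by rewrite big_ord0 (_ : [set _ | _] = setT) ?unit_measureT//; apply/seteqP; split.
rewrite big_ord_recl/= -(IH (fun i => C i.+1)) -first_digit_indep; last first.
  exact: (measurable_digits N (fun i => C i.+1)).
congr unit_measure; apply/seteqP; split => x /=.
  move=> h; split; first exact: (h 0).
  by move=> i iN; have := h i.+1 iN; rewrite /nth_digit iterSr.
move=> [h0 h] [|i] // iN; have := h i iN; by rewrite /nth_digit iterSr.
Qed.

End Digits.

(** * Product measures and resampling *)

Section Cylinders.
Variables (R : realType) (G : groupType).
Variables (d : measure_display) (B : measurableType d).

Definition cylinder (D : {fset G}) (C : G -> set B) : set (shift_space G B) :=
  [set b | forall g, g \in D -> C g (b g)].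

Lemma measurable_coordinate (g : G) :
  measurable_fun setT (fun b : shift_space G B => b g).
Proof.
move=> _ C mC; rewrite setTI; apply: sub_sigma_algebra.
by exists g, C.
Qed.

Lemma measurable_to_shift d' (T : measurableType d') (F : T -> shift_space G B) :
  (forall g, measurable_fun setT (fun t => F t g)) -> measurable_fun setT F.
Proof.
move=> mF; apply: (@measurability _ _ T (shift_space G B) setT F (@cylinders G d B)) => //.
move=> _ [_ [g [C [mC ->]]] <-].
have := mF g measurableT C mC; rewrite !setTI.
by congr measurable.
Qed.

Lemma measurable_cylinder D C : (forall g, measurable (C g)) ->
  measurable (cylinder D C).
Proof.
move=> mC; rewrite (_ : cylinder D C =
    \bigcap_(g in [set` D]) ((fun b : shift_space G B => b g) @^-1` C g)).
  apply: fin_bigcap_measurable => // g _; rewrite -[X in measurable X]setTI.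
  exact: measurable_coordinate.
by apply/seteqP; split => b h g; exact: h.
Qed.

Lemma cylinder_widen (D D' : {fset G}) C : (D `<=` D')%fset ->
  cylinder D C = cylinder D' (fun g => if g \in D then C g else setT).
Proof.
move=> /fsubsetP DD; apply/seteqP; split => b h g gD.
  by case: ifPn => // gD'; exact: h.
by have := h _ (DD _ gD); rewrite gD.
Qed.

Lemma cylinderI (D : {fset G}) C C' :
  cylinder D C `&` cylinder D C' = cylinder D (fun g => C g `&` C' g).
Proof.
apply/seteqP; split => b.
  by move=> [h h'] g gD; split; [exact: h|exact: h'].
by move=> h; split => g /h [].
Qed.

(** Cylinders generate the sigma-algebra and are stable under intersection, once both are written
    over a common finite index set. *)
Lemma shift_measure_unique (m1 m2 : {measure set (shift_space G B) -> \bar R}) :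
  (m1 setT < +oo)%E ->
  (forall D C, (forall g, measurable (C g)) ->
     m1 (cylinder D C) = m2 (cylinder D C)) ->
  forall E, measurable E -> m1 E = m2 E.
Proof.
move=> m1T m12; pose P := [set E | exists D C,
  (forall g, measurable (C g)) /\ E = cylinder D C].
have PT : P setT.
  by exists fset0, (fun=> setT); split=> //; apply/seteqP; split => b.
apply: (measure_unique P (fun=> setT)) => //.
- apply/seteqP; split; apply: smallest_sub; try exact: smallest_sigma_algebra.
    move=> _ [g [C [mC ->]]]; apply: sub_sigma_algebra.
    exists [fset g]%fset, (fun=> C); split => //.
    apply/seteqP; split => b /=.
      by move=> h g'; rewrite inE => /eqP ->.
    by apply; rewrite inE.
  by move=> _ [D [C [mC ->]]]; exact: measurable_cylinder.
- move=> _ _ [D [C [mC ->]]] [D' [C' [mC' ->]]].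
  rewrite (cylinder_widen _ (fsubsetUl D D')) (cylinder_widen _ (fsubsetUr D D')).
  rewrite cylinderI; do 2 eexists; split; last by reflexivity.
  by move=> g; apply: measurableI; case: ifP.
- by rewrite bigcup_const//; exists 0.
- by move=> _ [D [C [mC ->]]]; exact: m12.
Qed.

End Cylinders.

(** The digits of a uniform point of [[0, 1)] are independent and uniform; the injection [i] assigns
    a digit position to each group element. *)
Lemma exists_product_measure (R : realType) (G : groupType) (n : nat)
    (i : G -> nat) : injective i ->
  exists zeta : probability (shift_space G (digit n)) R,
    is_product_measure (@uniform_digit R n) zeta.
Proof.
move=> inj_i.
pose F (x : measurableTypeR R) : shift_space G (digit n) := fun g => nth_digit n (i g) x.
have mF : measurable_fun setT F.
  apply: measurable_to_shift => g _ C _; rewrite setTI.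
  have := @measurable_digits R n (i g).+1 (fun j => if j == i g then C else setT).
  congr measurable; apply/seteqP; split => x /=.
    by move=> /(_ _ (ltnSn _)); rewrite eqxx.
  by move=> h j _; case: eqP => // ->.
exists (pushforward_probability (@unit_measure R : probability _ R) mF) => D C mC.
rewrite pushforward_probabilityE.
(* The condition at position [j]; it is void, and gives a factor 1, unless [j] is the index of an
   element of [D]. *)
pose C' (j : nat) := [set k : digit n | forall g, g \in D -> i g = j -> C g k].
pose N := (\max_(g <- D) (i g).+1)%N.
have iN g : g \in D -> (i g < N)%N.
  by move=> gD; rewrite /N (big_rem g gD)/= leq_max ltnSn.
have C'E g : g \in D -> C' (i g) = C g.
  move=> gD; apply/seteqP; split => k; first exact.
  by move=> Ck g' _ /inj_i ->.
transitivity (@unit_measure R [set x | forall j, (j < N)%N -> C' j (nth_digit n j x)]).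
  congr (@unit_measure R); apply/seteqP; split => x /=.
    by move=> h j _ g gD <-; exact: h.
  by move=> h g gD; apply: (h _ (iN g gD)).
rewrite digits_indep -(big_mkord xpredT (fun j => @uniform_digit R n (C' j))).
rewrite (bigID (fun j => j \in map i D))/= [X in (_ * X)%E]big1 ?mule1; last first.
  move=> j jD; rewrite (_ : C' j = setT) ?uniform_digitT//.
  apply/seteqP; split => // k _ g gD ij; case/negP: jD; rewrite -ij.
  exact: map_f.
rewrite -big_filter (perm_big (map i D)); last first.
  apply: uniq_perm; rewrite ?filter_uniq ?iota_uniq ?map_inj_uniq ?fset_uniq//.
  move=> j; rewrite mem_filter mem_index_iota/=.
  by case: (boolP (j \in map i D)) => //= /mapP[g gD ->]; exact: iN.
rewrite big_map big_seq [RHS]big_seq; apply: eq_bigr => g gD.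
by rewrite C'E.
Qed.

Section Resample.
Variables (R : realType) (G : groupType) (n : nat).
Variable zeta : probability (shift_space G (digit n)) R.
Hypothesis zetaP : is_product_measure (@uniform_digit R n) zeta.

Definition update (g : G) (k : digit n) (b : shift_space G (digit n)) :
  shift_space G (digit n) := fun h => if h == g then k else b h.

Lemma measurable_update g k : measurable_fun setT (update g k).
Proof.
apply: measurable_to_shift => h; rewrite /update; case: eqP => // _.
exact: measurable_coordinate.
Qed.

Definition resample_measure g : {measure set (shift_space G (digit n)) -> \bar R} :=
  mscale (n.+1%:R^-1)%:nng
    (msum (fun k => pushforward_measure zeta (measurable_update g (inord k))) n.+1).

Lemma resample_measureE g E : resample_measure g E =
  (n.+1%:R^-1%:E * \sum_(k : digit n) zeta (update g k @^-1` E))%E.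
Proof.
rewrite /resample_measure/= /mscale/= /msum; congr (_ * _)%E.
by apply: eq_bigr => k _; rewrite /= /pushforward inord_val.
Qed.

(** It suffices to treat cylinders constrained at [g] as well. Writing [k] at [g] leaves either
    nothing or the cylinder without its condition at [g], so the average over [k] restores exactly
    the factor at [g]. *)
Lemma resample g E : measurable E -> zeta E = resample_measure g E.
Proof.
apply: (@shift_measure_unique R G _ (digit n) zeta (resample_measure g)).
  by rewrite [X in (X < _)%E](@probability_setT _ _ _ zeta) ltry.
move=> D0 C0 mC0; rewrite (cylinder_widen _ (fsubsetU1 g D0)).
set D := (g |` D0)%fset; set C : G -> set (digit n) := (fun h => if h \in D0 then C0 h else setT).
have mC h : measurable (C h) by [].
have zC D' : zeta (cylinder D' C) = (\prod_(h <- D') uniform_digit R (C h))%E.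
  exact: zetaP.
rewrite resample_measureE [LHS]zC.
have gD : g \in D by rewrite fset1U1.
have preE k : update g k @^-1` cylinder D C =
    if k \in C g then cylinder (D `\ g)%fset C else set0.
  apply/seteqP; split => b.
    move=> h; have := h g gD; rewrite /update eqxx => /mem_set ->.
    move=> g'; rewrite in_fsetD1 => /andP[g'g g'D].
    by have := h g' g'D; rewrite /update (negPf g'g).
  case: ifPn => // /set_mem Ck h g' g'D; rewrite /update.
  case: eqP => [->//|/eqP g'g]; apply: h.
  by rewrite in_fsetD1 g'g.
rewrite (big_fsetD1 g)//= uniform_digitE EFinM -muleA -sumEFin.
congr (_ * _)%E; rewrite ge0_sume_distrl; last by move=> k _; rewrite lee_fin.
apply: eq_bigr => k _; rewrite preE.
case: ifPn => _; last by rewrite measure0 mul0e.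
by rewrite mul1e zC.
Qed.

(** Fubini for the single coordinate [g]: the form in which independence of the digit at [g] is used
    below. *)
Lemma ge0_integral_resample g (F : shift_space G (digit n) -> \bar R) :
  measurable_fun setT F -> (forall b, 0 <= F b)%E ->
  (\int[zeta]_b F b = n.+1%:R^-1%:E * \int[zeta]_b \sum_(k : digit n) F (update g k b))%E.
Proof.
move=> mF F0; rewrite (eq_measure_integral (resample_measure g)); last first.
  by move=> E mE _; exact: resample.
rewrite ge0_integral_mscale//= ge0_integral_measure_sum//=.
rewrite ge0_integral_sum//; last first.
  by move=> k; apply: measurableT_comp => //; exact: measurable_update.
apply: congr1; apply: eq_bigr => k _.
rewrite ge0_integral_pushforward//= ?preimage_setT; first by rewrite inord_val.
exact: measurable_update.
Qed.

End Resample.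

(** * Random carries *)

Lemma geometric_le0 (R : realType) (C r x : R) : 0 <= r -> r < 1 ->
  (forall k, x <= C * r ^+ k) -> x <= 0.
Proof.
move=> r0 r1 xC; have cvg0 : (fun k => C * r ^+ k) @ \oo --> (C * 0).
  by apply: cvgMl_tmp; apply: cvg_expr; rewrite ger0_norm.
rewrite -(mulr0 C); apply: (cvgr_to_ge cvg0); exact: nearW.
Qed.

Section RandomCarry.
Variables (R : realType) (G : groupType) (lt : rel G).
Hypothesis ltP : left_invariant_order lt.
Variables (ss : seq G) (al : G -> int) (n : nat).
Hypothesis ss_gt1 : forall s, s \in ss -> lt 1%g s.
Hypothesis alM : \sum_(s <- ss) `|al s| < n.+1%:Z.
Variables (w : G -> int) (K : int).
Hypothesis wK : forall g, `|w g| + n%:Z <= K.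
Variable zeta : probability (shift_space G (digit n)) R.
Hypothesis zetaP : is_product_measure (@uniform_digit R n) zeta.
Local Notation W := (shift_space G (digit n)).

Definition translate (b : W) (g : G) : int := (b g : nat)%:Z + w g.

Local Notation bound k c g b := (carry_bound ss al n.+1 (translate b) K k c g).

Let K0 : 0 <= K.
Proof. by apply: le_trans (wK 1%g); rewrite addr_ge0. Qed.

Lemma translate_le b g : `|translate b g| <= K.
Proof.
apply: le_trans (wK g); apply: (le_trans (ler_normD _ _)).
by rewrite addrC lerD2l /= lez_nat -ltnS ltn_ord.
Qed.

Lemma bound_gap_ge0 k g b : 0 <= bound k true g b - bound k false g b.
Proof. by rewrite subr_ge0; apply: carry_bound_le => //; exact: translate_le. Qed.

Lemma measurable_translate g : preim_measurable (fun b => translate b g).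
Proof.
rewrite /translate; apply: (@preim_measurable_comp _ _ (digit n) _ (fun b : W => b g)
  (fun j : digit n => (j : nat)%:Z + w g)) => Y.
by have := @measurable_coordinate G _ (digit n) g measurableT Y; rewrite setTI; exact.
Qed.

Lemma measurable_bound k c g : preim_measurable (fun b => bound k c g b).
Proof.
elim: k c g => [|k IH] c g; first by move=> Y; rewrite /= preimage_cst; case: ifP.
apply: (preim_measurable_comp (divz^~ n.+1%:Z)).
apply: (preim_measurable2 (fun u v => u - v)); first exact: measurable_translate.
apply: preim_measurable_sum => s.
exact: (preim_measurable_comp (fun u : int => u *~ al s)).
Qed.

Lemma translate_update g h j b : lt h g -> translate (update h j b) g = translate b g.
Proof.
move=> hg; rewrite /translate /update ifN//; apply/eqP => e.
by case: ltP => irr _ _ _; move: hg; rewrite e irr.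
Qed.

Lemma lt_mul g s : s \in ss -> lt g (g * s)%g.
Proof.
move=> /ss_gt1 s1; case: ltP => _ _ _ /(_ g _ _ s1).
by rewrite mulg1.
Qed.

Lemma lt_mul_trans h g s : lt h g -> s \in ss -> lt h (g * s)%g.
Proof.
by move=> hg sS; case: ltP => _ tr _ _; apply: (tr g) => //; exact: lt_mul.
Qed.

(** The recursion started at [g] visits only places at or after [g], so a digit at an earlier place
    is never read. *)
Lemma bound_update k c g h j b : lt h g -> bound k c g (update h j b) = bound k c g b.
Proof.
elim: k c g => [//|k IH] c g hg /=; rewrite /carry_step translate_update//.
congr (divz (_ - _) _); rewrite big_seq [RHS]big_seq; apply: eq_bigr => s sS.
by rewrite IH//; exact: lt_mul_trans.
Qed.

Definition gap k g (b : W) : \bar R := ((bound k true g b - bound k false g b)%:~R)%:E.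

Lemma gap_ge0 k g b : (0 <= gap k g b)%E.
Proof. by rewrite lee_fin ler0z bound_gap_ge0. Qed.

Lemma measurable_gap k g : measurable_fun setT (gap k g).
Proof.
apply/measurable_EFinP.
apply: (@preim_measurable_fun _ _ _ _ _ (fun b => bound k true g b - bound k false g b)
  (fun j : int => j%:~R : R)).
by apply: (preim_measurable2 (fun u v => u - v)); exact: measurable_bound.
Qed.

(* A uniform digit is independent of the carries entering its place, and the  *)
(* rounded quotients average to the exact one; so one step of the recursion   *)
(* contracts the mean gap by the factor [sum |al| / n.+1].                    *)
Lemma sum_gap_update k g b :
  (\sum_(j : digit n) gap k.+1 g (update g j b) =
   \sum_(s <- ss) (`|al s|%:~R)%:E * gap k (g * s)%g b)%E.
Proof.
pose S c := \sum_(s <- ss) bound k (c (+) (0 <= al s)) (g * s)%g b *~ al s.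
have E c j : bound k.+1 c g (update g j b) = divz ((j : nat)%:Z + (w g - S c)) n.+1.
  rewrite /= /carry_step /translate /update eqxx addrA; congr (divz (_ - _) _).
  rewrite /S big_seq [RHS]big_seq; apply: eq_bigr => s sS.
  by rewrite bound_update//; exact: lt_mul.
transitivity ((\sum_(j : digit n) (bound k.+1 true g (update g j b) -
    bound k.+1 false g (update g j b)))%:~R%:E : \bar R).
  by rewrite rmorph_sum/= -sumEFin.
under eq_bigr => j _ do rewrite !E.
rewrite sumrB !sum_divz// opprD addrACA subrr add0r opprK addrC.
rewrite /S -sumrB rmorph_sum/= -sumEFin; apply: eq_bigr => s _.
rewrite /gap -EFinM -intrM; congr (_%:~R%:E).
rewrite !mulrzz -mulrBl; case: (leP 0 (al s)) => h /=.
  by rewrite ger0_norm// mulrC.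
by rewrite ltr0_norm//; ring.
Qed.

Definition rho : R := (\sum_(s <- ss) `|al s|)%:~R / n.+1%:R.

Lemma rho_ge0 : 0 <= rho.
Proof. by rewrite divr_ge0// ler0z sumr_ge0. Qed.

Lemma rho_lt1 : rho < 1.
Proof. by rewrite ltr_pdivrMr// mul1r -[n.+1%:R]/(n.+1%:~R) ltr_int. Qed.

Lemma integral_gap_le k g :
  (\int[zeta]_b gap k g b <= ((2 * K)%:~R * rho ^+ k)%:E)%E.
Proof.
elim: k g => [|k IH] g.
  rewrite expr0 mulr1 /gap/= opprK.
  rewrite (integral_cst _ measurableT ((K + K)%:~R%:E)) [X in (_ * X)%E](@probability_setT _ _ _ zeta) mule1.
  by rewrite lee_fin ler_int mulr2n mulrDl mul1r.
(* The digit at [g] itself is averaged out; what is left involves only the gaps at the places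
   [g * s], to which the induction hypothesis applies. *)
rewrite (ge0_integral_resample zetaP g); last 2 first.
- exact: measurable_gap.
- exact: gap_ge0.
under eq_integral => b _ do rewrite sum_gap_update.
have al0 s : (0 <= (`|al s|%:~R : R)%:E)%E by rewrite lee_fin ler0z.
rewrite ge0_integral_sum//; last 2 first.
- move=> s; apply: emeasurable_funM => //; exact: measurable_gap.
- by move=> s b _; rewrite mule_ge0// gap_ge0.
apply: (@le_trans _ _ (n.+1%:R^-1%:E * \sum_(s <- ss) (`|al s|%:~R)%:E *
    ((2 * K)%:~R * rho ^+ k)%:E))%E.
  rewrite lee_pmul2l// ?lte_fin ?invr_gt0//.
  apply: lee_sum => s _; rewrite ge0_integralZl//.
  - by apply: lee_wpmul2l.
  - exact: measurable_gap.
  - by move=> b _; exact: gap_ge0.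
under eq_bigr => s _ do rewrite -EFinM.
rewrite sumEFin -EFinM lee_fin -mulr_suml exprS /rho rmorph_sum/=.
by rewrite le_eqVlt; apply/orP; left; apply/eqP; ring.
Qed.

Definition stuck g := [set b : W | forall k, bound k true g b != bound k false g b].

Lemma measurable_bound_eq k g :
  measurable [set b : W | bound k true g b == bound k false g b].
Proof.
exact: (preim_measurable2 (fun u v => u == v) (@measurable_bound k true g)
  (@measurable_bound k false g) [set true]).
Qed.

Lemma measurable_stuck g : measurable (stuck g).
Proof.
rewrite (_ : stuck g = \bigcap_k ~` [set b : W | bound k true g b == bound k false g b]).
  by apply: bigcap_measurableType => k _; apply: measurableC; exact: measurable_bound_eq.
by apply/seteqP; split => b h k => [_|]; [exact/negP|exact/negP/h].
Qed.

(** Gaps are integers, so on [stuck g] the gap is at least 1 at every depth. The measure is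
    therefore at most the mean gap, which decays geometrically. *)
Lemma stuck_null g : zeta (stuck g) = 0%E.
Proof.
have le k : (zeta (stuck g) <= ((2 * K)%:~R * rho ^+ k)%:E)%E.
  apply: le_trans (integral_gap_le k g).
  rewrite -[X in zeta X]setIT -integral_indic//; last exact: measurable_stuck.
  apply: ge0_le_integral => //.
  - by apply/measurable_EFinP; apply: measurable_indic; exact: measurable_stuck.
  - exact: measurable_gap.
  - move=> b _; rewrite indicE; case: (boolP (b \in stuck g)) => [/set_mem sb|_].
      rewrite lee_fin ler1z; have := bound_gap_ge0 k g b.
      by rewrite le_eqVlt eq_sym subr_eq0 (negPf (sb k)).
    exact: gap_ge0.
have fin : zeta (stuck g) \is a fin_num.
  by apply: fin_num_measure; exact: measurable_stuck.
rewrite -(fineK fin); congr (_%:E); apply/eqP; rewrite eq_le fine_ge0 ?andbT//.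
apply: (@geometric_le0 _ (2 * K)%:~R rho); rewrite ?rho_ge0 ?rho_lt1// => k.
by rewrite -lee_fin fineK.
Qed.

Lemma carry_good_ae (i : G -> nat) : injective i ->
  zeta.-negligible (~` [set b | carry_good ss al n.+1 (translate b) K]).
Proof.
(* A countable union of null sets, indexed through [i]; an index outside the image of [i] gives the
   empty set. *)
move=> inj_i; pose F m := [set b | exists2 g, i g = m & stuck g b].
apply: (@negligibleS _ _ _ _ (\bigcup_m F m)).
  move=> b /= /existsNP[g Hg]; exists (i g) => //; exists g => // k.
  by apply/negP => e; apply: Hg; exists k.
apply: negligible_bigcup => m.
have [[g ig]|nog] := pselect (exists g, i g = m).
  apply: (@negligibleS _ _ _ _ (stuck g)).
    by move=> b [g']; rewrite -ig => /inj_i ->.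
  by apply/negligibleP; [exact: measurable_stuck|exact: stuck_null].
apply: (@negligibleS _ _ _ _ set0); last exact: negligible_set0.
by move=> b [g' ig' _]; apply: nog; exists g'.
Qed.

Definition carry_at (b : W) : G -> int := carry ss al n.+1 (translate b) K.

Lemma measurable_carry g : preim_measurable (fun b => carry_at b g).
Proof.
apply: preim_measurableP => j.
(* The value [j] arises either as the common bound at some depth or, on [stuck g], as the default
   [0]. *)
rewrite (_ : _ @^-1` _ =
    (\bigcup_k ([set b : W | bound k true g b == bound k false g b] `&`
      (fun b => bound k true g b) @^-1` [set j])) `|`
    (stuck g `&` (if j == 0 then setT else set0))).
  apply: measurableU.
    apply: bigcupT_measurable => k; apply: measurableI.
      exact: measurable_bound_eq.
    exact: measurable_bound.
  by apply: measurableI; [exact: measurable_stuck|case: ifP].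
apply/seteqP; split => b.
  move=> /= cj; have [[k ek]|nk] := pselect (exists k, bound k true g b == bound k false g b).
    left; exists k => //; split => //=; rewrite -cj.
    by apply/esym/carryE => //; exact: translate_le.
  right; split; first by move=> k; apply/negP => e; apply: nk; exists k.
  move: cj; rewrite /carry_at /carry /first_agreement; case: pselect => // _ <-.
  by rewrite eqxx.
move=> [[k _ [/= ek <-]]|[/= st]].
  by apply: carryE => //; exact: translate_le.
case: eqP => // -> _; rewrite /carry_at /carry /first_agreement.
by case: pselect => // -[k ek]; have := st k; rewrite ek.
Qed.

Lemma carry_update g h j b : lt h g -> carry_at (update h j b) g = carry_at b g.
Proof.
move=> hg; rewrite /carry_at /carry; congr first_agreement.
by apply/funext => k; apply/funext => c; exact: bound_update.
Qed.

Definition carry_remainder (b : W) (g : G) : int :=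
  modz (translate b g - shift_sum ss al (carry_at b) g) n.+1.

(** The map b to b' of the carries. It is defined for every configuration, so its triangular form
    holds everywhere and not just almost everywhere. *)
Definition carry_map (b : W) : W := fun g => inord `|carry_remainder b g|%N.

Lemma carry_mapE b g : ((carry_map b g : nat)%:Z = carry_remainder b g).
Proof.
have r0 : 0 <= carry_remainder b g by rewrite modz_ge0.
rewrite /carry_map inordK ?gez0_abs// -ltz_nat gez0_abs//.
exact: ltz_pmod.
Qed.

Lemma measurable_remainder g : preim_measurable (fun b => carry_remainder b g).
Proof.
apply: (preim_measurable_comp (modz^~ n.+1%:Z)).
apply: (preim_measurable2 (fun u v => u - v)); first exact: measurable_translate.
apply: preim_measurable_sum => s.
by apply: (preim_measurable_comp (fun u : int => u *~ al s)); exact: measurable_carry.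
Qed.

Lemma measurable_carry_map : measurable_fun setT carry_map.
Proof.
apply: measurable_to_shift => g.
exact: (preim_measurable_fun (fun r : int => inord `|r|%N : digit n) (measurable_remainder g)).
Qed.

Lemma shift_sum_carry_update g h j b : h = g \/ lt h g ->
  shift_sum ss al (carry_at (update h j b)) g = shift_sum ss al (carry_at b) g.
Proof.
move=> hg; rewrite /shift_sum big_seq [RHS]big_seq; apply: eq_bigr => s sS.
by rewrite carry_update//; case: hg => [->|hg]; [exact: lt_mul|exact: lt_mul_trans].
Qed.

Lemma carry_map_update g h j b : lt h g ->
  carry_map (update h j b) g = carry_map b g.
Proof.
move=> hg; rewrite /carry_map /carry_remainder translate_update//.
by rewrite shift_sum_carry_update//; right.
Qed.

(** The carries entering [g] do not depend on the digit at [g]. As that digit [j] varies, the new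
    digit is [j + z] modulo [n.+1] with [z] fixed, a permutation of the digits. *)
Lemma sum_carry_map_update g (C : set (digit n)) b :
  \sum_(j : digit n) ((carry_map (update g j b) g \in C)%:R : R) =
  \sum_(j : digit n) (j \in C)%:R.
Proof.
pose z := w g - shift_sum ss al (carry_at b) g.
pose h (j : digit n) : digit n := inord `|modz ((j : nat)%:Z + z) n.+1|%N.
have hE j : carry_map (update g j b) g = h j.
  rewrite /carry_map /carry_remainder /h shift_sum_carry_update; last by left.
  by rewrite /translate /update eqxx addrA.
have hval j : (h j : nat)%:Z = modz ((j : nat)%:Z + z) n.+1.
  rewrite /h inordK ?gez0_abs ?modz_ge0// -ltz_nat gez0_abs ?modz_ge0//.
  exact: ltz_pmod.
have h_inj : injective h.
  move=> j j' /(congr1 (fun k : digit n => (k : nat)%:Z)); rewrite !hval => /eqP.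
  rewrite eqz_modDr !modz_small ?ltz_nat ?ltn_ord//=.
  by move=> /eqP [/val_inj].
under eq_bigr => j _ do rewrite hE.
by rewrite [RHS](reindex_inj h_inj).
Qed.

Lemma min_exists (s : seq G) : s != [::] ->
  exists2 g, g \in s & forall h, h \in s -> h != g -> lt g h.
Proof.
case: ltP => irr tr tot _.
elim: s => [//|x [|y s] IH] _.
  by exists x; rewrite ?mem_head// => h; rewrite inE => /eqP ->; rewrite eqxx.
have [//|g gs gmin] := IH.
have [xg|xg] := eqVneq x g.
  exists g; first by rewrite inE gs orbT.
  by move=> h; rewrite inE => /orP[/eqP ->|]; [rewrite xg eqxx|exact: gmin].
have /orP[xlt|glt] := tot _ _ xg.
  exists x; first exact: mem_head.
  move=> h; rewrite inE => /orP[/eqP ->|hs hx]; first by rewrite eqxx.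
  have [-> //|hg] := eqVneq h g.
  exact: tr xlt (gmin _ hs hg).
exists g; first by rewrite inE gs orbT.
by move=> h; rewrite inE => /orP[/eqP -> //|]; exact: gmin.
Qed.

(** Induction on the size of [D], removing its smallest place [g]: the old digit at [g] influences
    no new digit at a larger place, so it can be averaged out first. *)
Lemma carry_map_cylinder (D : {fset G}) (C : G -> set (digit n)) :
  zeta (carry_map @^-1` cylinder D C) = (\prod_(g <- D) uniform_digit R (C g))%E.
Proof.
have mcyl D' : measurable (carry_map @^-1` cylinder D' C).
  rewrite -[X in measurable X]setTI; apply: measurable_carry_map => //.
  exact: measurable_cylinder.
move: {2}(#|` D|)%N (erefl #|` D|%N) => N; elim: N D => [|N IH] D DN.
  have -> : D = fset0 by apply: cardfs0_eq.
  rewrite big_seq_fset0 (_ : _ @^-1` _ = setT); first exact: probability_setT.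
  by apply/seteqP; split => b.
have Dn : (D : seq G) != [::] by apply/eqP => e; move: DN; rewrite -[X in X = _]/(size (D : seq G)) e.
have [g gD gmin] := min_exists Dn.
pose D' := (D `\ g)%fset.
have D'N : #|` D'| = N by move: DN; rewrite (cardfsD1 g) gD => -[].
pose A := carry_map @^-1` cylinder D' C.
have AU j b : (update g j b \in A) = (b \in A).
  have E h : h \in D' -> carry_map (update g j b) h = carry_map b h.
    rewrite in_fsetD1 => /andP[hg hD]; apply: carry_map_update.
    exact: gmin.
  by apply/idP/idP => /set_mem /= H; apply/mem_set => h hD /=;
    have := H h hD; rewrite E.
rewrite -[X in zeta X]setIT -integral_indic//.
rewrite (ge0_integral_resample zetaP g); last 2 first.
- by apply/measurable_EFinP; apply: measurable_indic.
- by move=> b; rewrite lee_fin.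
pose c : R := \sum_(j : digit n) (j \in C g)%:R.
have c0 : 0 <= c by rewrite sumr_ge0.
(* Under resampling at [g] the event [A] is unchanged, while the new digit at [g] takes each value
   once; so the indicators sum to the count [c] times that of [A]. *)
rewrite (eq_integral (fun b => c%:E * (\1_A b)%:E)%E); last first.
  move=> b _; rewrite sumEFin -EFinM; congr (_%:E).
  rewrite /c -(sum_carry_map_update g (C g) b) mulr_suml; apply: eq_bigr => j _.
  rewrite !indicE -(AU j) -natrM mulnb; congr (_%:R); congr nat_of_bool.
  apply/idP/andP => [/set_mem /= H|[/set_mem /= Cg /set_mem /= HA]].
    split; apply/mem_set; first exact: (H g).
    by move=> h; rewrite in_fsetD1 => /andP[_]; exact: H.
  apply/mem_set => h hD; have [->//|hg] := eqVneq h g.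
  by apply: HA; rewrite in_fsetD1 hg.
rewrite ge0_integralZl//; last first.
  by apply/measurable_EFinP; apply: measurable_indic; exact: mcyl.
rewrite integral_indic//; last exact: mcyl.
rewrite setIT (big_fsetD1 g)//= -(IH _ D'N) uniform_digitE EFinM muleA.
by [].
Qed.

Lemma carry_map_preserves E : measurable E -> zeta (carry_map @^-1` E) = zeta E.
Proof.
move=> mE; apply: (@shift_measure_unique R G _ (digit n)
  (pushforward_measure zeta measurable_carry_map) zeta) mE => [|D C mC].
  by rewrite /= /pushforward preimage_setT
     [X in (X < _)%E](@probability_setT _ _ _ zeta) ltry.
by rewrite /= /pushforward [LHS]carry_map_cylinder; apply/esym; exact: zetaP.
Qed.

Lemma carry_map_eq b g : carry_good ss al n.+1 (translate b) K ->
  (carry_map b g : nat)%:Z =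
  translate b g - shift_sum ss al (carry_at b) g - carry_at b g * n.+1%:Z.
Proof.
move=> good; rewrite carry_mapE /carry_remainder /modz.
by rewrite -(carry_is_carry _ _ (translate_le b) good).
Qed.

End RandomCarry.

(** * Bounded solutions *)

Section Solution.
Variables (R : realType) (G : groupType) (ss : seq G) (al : G -> int) (n : nat).
Hypothesis alM : \sum_(s <- ss) `|al s| < n.+1%:Z.
Local Notation M := (n.+1%:R : R).
Local Notation Sg := (shift_sum ss al).
Local Notation r := (rho R ss al n).
Implicit Types (v y : G -> R).

Let r0 : 0 <= r. Proof. exact: rho_ge0. Qed.
Let r1 : r < 1. Proof. exact: rho_lt1. Qed.

Lemma shift_sumB y y' g : Sg (fun h => y h - y' h) g = Sg y g - Sg y' g.
Proof. by rewrite /shift_sum -sumrB; apply: eq_bigr => s _; rewrite mulrzBl. Qed.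

Lemma shift_sumD y y' g : Sg (fun h => y h + y' h) g = Sg y g + Sg y' g.
Proof. by rewrite /shift_sum -big_split; apply: eq_bigr => s _; rewrite mulrzDl. Qed.

Lemma shift_sum_intr (c : G -> int) g :
  Sg (fun h => (c h)%:~R : R) g = (Sg c g)%:~R.
Proof. by rewrite /shift_sum rmorph_sum/=; apply: eq_bigr => s _; rewrite rmorphMz. Qed.

(** [M * r] is the total size of the coefficients; in this form, division by [M] leaves the
    contraction ratio [r]. *)
Lemma shift_sum_le y (C : R) : (forall g, `|y g| <= C) ->
  forall g, `|Sg y g| <= M * r * C.
Proof.
move=> yC g; rewrite /rho mulrC [M * _]mulrC divfK// rmorph_sum/= mulr_sumr.
apply: le_trans (ler_norm_sum _ _ _) _; apply: ler_sum => s _.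
by rewrite -mulrzr normrM intr_norm ler_wpM2r.
Qed.

(** Solving the equation for [y] turns a bound [C] into [C * r]; iterating forces [y = 0]. *)
Lemma bounded_kernel y (C : R) : (forall g, `|y g| <= C) ->
  (forall g, M * y g + Sg y g = 0) -> forall g, y g = 0.
Proof.
move=> yC ye g.
have le k h : `|y h| <= C * r ^+ k.
  elim: k h => [|k IH] h; first by rewrite mulr1.
  have -> : y h = - Sg y h / M.
    by apply: (mulfI (_ : M != 0)) => //; rewrite mulrCA divff// mulr1; apply/eqP; rewrite -addr_eq0 ye.
  rewrite mulNr normrN normrM normfV (ger0_norm (ler0n R n.+1)) ler_pdivrMr//.
  by apply: le_trans (shift_sum_le IH h) _; rewrite exprS le_eqVlt; apply/orP; left; apply/eqP; ring.
apply/eqP; rewrite -normr_le0; exact: (@geometric_le0 _ C r).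
Qed.

(** Fixed-point iteration for [y = (v - Sg y) / M], started at [0]. *)
Fixpoint sol_approx v (k : nat) (g : G) : R :=
  if k is k'.+1 then (v g - Sg (sol_approx v k') g) / M else 0.

Definition sol v (g : G) : R := limn (fun k => sol_approx v k g).

Section Bounded.
Variables (v : G -> R) (D : R).
Hypothesis vD : forall g, `|v g| <= D.

Let D0 : 0 <= D. Proof. exact: le_trans (vD 1%g). Qed.

Lemma sol_approx_le k g : `|sol_approx v k g| <= D.
Proof.
elim: k g => [|k IH] g /=; first by rewrite normr0.
rewrite normrM normfV (ger0_norm (ler0n R n.+1)) ler_pdivrMr//.
apply: le_trans (ler_normB _ _) _.
apply: le_trans (lerD (vD g) (shift_sum_le IH g)) _.
(* Integrality again: total coefficient size plus 1 is at most [M], so the bound [D] on [v] is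
   inherited unchanged by every iterate. *)
have : (\sum_(s <- ss) `|al s|)%:~R + 1 <= M.
  by rewrite -[1]/(1%:~R) -[M]/(n.+1%:Z%:~R) -intrD ler_int lezD1.
rewrite /rho [M * _]mulrC divfK// => h.
by rewrite -{1}(mul1r D) -mulrDl mulrC ler_wpM2l// addrC.
Qed.

Lemma sol_approx_diff k g :
  `|sol_approx v k.+1 g - sol_approx v k g| <= D * r ^+ k.
Proof.
elim: k g => [|k IH] g.
  by rewrite mulr1 [sol_approx v 0 g]/= subr0; exact: sol_approx_le.
have -> : sol_approx v k.+2 g - sol_approx v k.+1 g =
    - Sg (fun h => sol_approx v k.+1 h - sol_approx v k h) g / M.
  rewrite shift_sumB [sol_approx v k.+2 g]/= [in LHS](_ : sol_approx v k.+1 g =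
    (v g - Sg (sol_approx v k) g) / M)//; ring.
rewrite mulNr normrN normrM normfV (ger0_norm (ler0n R n.+1)) ler_pdivrMr//.
apply: le_trans (shift_sum_le IH g) _; rewrite exprS le_eqVlt.
by apply/orP; left; apply/eqP; ring.
Qed.

Lemma sol_approx_cvg g : sol_approx v ^~ g @ \oo --> sol v g.
Proof.
pose u k := sol_approx v k.+1 g - sol_approx v k g.
suff : cvgn (series u).
  rewrite (_ : series u = sol_approx v ^~ g)//.
  by apply/funext => k; rewrite /series/= telescope_sumr// subr0.
apply: normed_cvg.
apply: (@series_le_cvg _ _ (geometric D r)) => //.
- by move=> k /=.
- move=> k; apply: mulr_ge0; [exact: D0|exact: exprn_ge0].
- by move=> k; exact: sol_approx_diff.
- by apply: is_cvg_geometric_series; rewrite ger0_norm.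
Qed.

Lemma sol_le g : `|sol v g| <= D.
Proof.
apply: (cvgr_to_le (cvg_norm (@sol_approx_cvg g))).
by apply: nearW => k; exact: sol_approx_le.
Qed.

Lemma shift_sum_cvg (u : nat -> G -> R) y g :
  (forall h, u ^~ h @ \oo --> y h) -> (fun k => Sg (u k) g) @ \oo --> Sg y g.
Proof.
move=> uy; rewrite /shift_sum; elim: (ss) => [|s t IH].
  by rewrite big_nil; under eq_fun => k do rewrite big_nil; exact: cvg_cst.
rewrite big_cons -mulrzr; under eq_fun => k do rewrite big_cons -mulrzr.
by apply: cvgD => //; exact: cvgMr_tmp.
Qed.

Lemma sol_eq g : M * sol v g + Sg (sol v) g = v g.
Proof.
suff -> : sol v g = (v g - Sg (sol v) g) / M.
  by rewrite mulrCA divff// mulr1 subrK.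
have h1 := @sol_approx_cvg g.
rewrite -cvg_shiftS in h1; apply: cvg_unique h1 _ => //=.
apply: cvgMr_tmp; apply: cvgB; first exact: cvg_cst.
exact: shift_sum_cvg sol_approx_cvg.
Qed.

Lemma sol_unique y (C : R) : (forall g, `|y g| <= C) ->
  (forall g, M * y g + Sg y g = v g) -> y = sol v.
Proof.
move=> yC ye; apply/funext => g; apply/eqP; rewrite -subr_eq0; apply/eqP.
apply: (@bounded_kernel (fun g => y g - sol v g) (C + D)) => h.
  exact: le_trans (ler_normB _ _) (lerD (yC h) (sol_le h)).
by rewrite shift_sumB mulrBr addrACA -opprD ye sol_eq subrr.
Qed.

End Bounded.

Lemma measurable_sol d (T : measurableType d) (v : T -> G -> R) (D : R) :
  (forall t g, `|v t g| <= D) ->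
  (forall g, measurable_fun setT (fun t => v t g)) ->
  forall g, measurable_fun setT (fun t => sol (v t) g).
Proof.
move=> vD mv g.
apply: (@measurable_fun_cvg _ _ _ _ (fun k t => sol_approx (v t) k g)) => [k|t _]; last first.
  exact: (@sol_approx_cvg _ _ (vD t)).
elim: k g => [|k IH] g /=; first exact: measurable_cst.
apply: measurable_funM => //; apply: measurable_funB => //.
apply: measurable_sum => s; under eq_fun => t do rewrite -mulrzr.
exact: measurable_funM.
Qed.

End Solution.

(** * The Borel structure of a dual group *)

Section Circle.
Variable R : realType.
Local Open Scope quotient_scope.
Local Notation C := (circle R).
Local Notation Q := (Quotient.quot (int_zmodClosed R)).

Definition circle_pi (x : R) : C := \pi_Q x.

Lemma circle_pi_eq x y : circle_pi x = circle_pi y <-> (x - y) \is a Num.int.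
Proof.
rewrite /circle_pi; split.
  move=> h; have {}h : \pi_Q x = \pi_Q y := h.
  by move/eqP: h; rewrite -Quotient.idealrBE.
move=> h; have : \pi_Q x == \pi_Q y by rewrite -Quotient.idealrBE.
by move/eqP.
Qed.

Lemma circle_pi_surj (c : C) : circle_pi (repr (c : Quotient.quot (int_zmodClosed R))) = c.
Proof. exact: reprK. Qed.

Lemma circle_piB x y : circle_pi (x - y) = circle_pi x - circle_pi y.
Proof.
exact: (raddfB (\pi_Q)).
Qed.

HB.instance Definition _ := GRing.isZmodMorphism.Build R C circle_pi circle_piB.

Definition frac (x : R) : R := x - (Num.floor x)%:~R.

Definition lift (c : C) : R := frac (repr (c : Quotient.quot (int_zmodClosed R))).

Lemma liftK : cancel lift circle_pi.
Proof.
move=> c; rewrite -[RHS]circle_pi_surj; apply/circle_pi_eq.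
by rewrite /lift /frac addrAC subrr add0r rpredN intr_int.
Qed.

Lemma lift_ge0 c : 0 <= lift c.
Proof. by rewrite subr_ge0 floor_le. Qed.

Lemma lift_lt1 c : lift c < 1.
Proof.
by have /andP[_ h] := floor_itv (repr (c : Quotient.quot (int_zmodClosed R)));
  rewrite ltrBlDr addrC -intrD1.
Qed.

Lemma fracD_int x y : y \is a Num.int -> frac (x + y) = frac x.
Proof.
move=> /intrP[m ->]; rewrite /frac floorDrz ?intr_int// intrKfloor rmorphD/=.
ring.
Qed.

Lemma lift_pi x : lift (circle_pi x) = frac x.
Proof.
have /circle_pi_eq h := circle_pi_surj (circle_pi x).
rewrite /lift -[X in frac X](subrK x) addrC; exact: fracD_int.
Qed.

Lemma measurable_frac : measurable_fun setT (frac : measurableTypeR R -> measurableTypeR R).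
Proof.
apply: measurable_funB => //.
apply: (preim_measurable_fun (fun j : int => j%:~R : R)).
exact: floor_preim_measurable.
Qed.

(** Lower semicontinuity of [lift]: for [t >= 0] the preimage in the line is a union of open
    intervals. As open rays generate the Borel sets, this makes [lift] measurable. *)
Lemma open_lift_gt (t : R) : open [set c : C | t < lift c].
Proof.
suff : open (circle_pi @^-1` [set c : C | t < lift c]) by [].
rewrite (_ : _ @^-1` _ = if t < 0 then setT else
    \bigcup_(j : int) `]j%:~R + t, j%:~R + 1[%classic).
  case: ifP => _; first exact: openT.
  by apply: bigcup_open => j _; exact: interval_open.
apply/seteqP; split => x /=; rewrite lift_pi /frac.
  case: (ltP t 0) => [//|t0 tx]; exists (Num.floor x) => //=.
  rewrite in_itv/=; have := floorD1_gt x; rewrite intrD1 => ->.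
  by rewrite andbT addrC -ltrBrDr.
case: (ltP t 0) => [t0 _|t0 [j _ /=]].
  by apply: lt_le_trans t0 _; rewrite subr_ge0 floor_le.
rewrite in_itv/= => /andP[h1 h2]; rewrite (@floor_def _ _ j).
  by rewrite ltrBrDr addrC.
by rewrite intrD1 h2 andbT (le_trans _ (ltW h1))// lerDl.
Qed.

End Circle.

Section DualBorel.
Variables (R : realType) (A : zmodType).
Local Notation X := (dual_borel R A).

Definition coord (a : A) (chi : X) : R := lift (dual_fun chi a).

Lemma coord_pi a (chi : X) : @circle_pi R (coord a chi) = dual_fun chi a.
Proof. exact: liftK. Qed.

Lemma measurable_coord a : measurable_fun setT (coord a).
Proof.
apply: (measurability _ (RGenOInfty.measurableE R)) => _ [_ [t ->] <-].
rewrite setTI; apply: sub_sigma_algebra.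
exists ((fun h : {ptws A -> circle R} => h a) @^-1` [set c | t < lift c]).
  have cont : continuous (fun h : {ptws A -> circle R} => h a).
    exact: (@proj_continuous A (fun=> circle R) a).
  by move/continuousP : cont; apply; exact: open_lift_gt.
by apply/seteqP; split => chi /=; rewrite in_itv/= andbT.
Qed.

(* The sets [chi' : |coord a chi' - coord a chi| < e for a in s] need not be  *)
(* open (lift is discontinuous at 0), but they refine the neighbourhoods.     *)
Lemma dual_open_coord (O : set (dual_top R A)) (chi : X) : open O -> O chi ->
  exists (s : seq A) (e : R), 0 < e /\
    forall psi : X, (forall a, a \in s -> `|coord a psi - coord a chi| < e) -> O psi.
Proof.
move=> [U oU <-] /= Uchi.
pose g : {ptws A -> circle R} := dual_fun chi.
pose V (p : seq A * R) := [set h : {ptws A -> circle R} |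
  forall a, a \in p.1 -> `|lift (h a) - lift (g a)| < p.2].
pose F := filter_from [set p : seq A * R | 0 < p.2] V.
have FF : Filter F.
  apply: filter_from_filter; first by exists ([::], 1); exact: ltr01.
  move=> [s e] [s' e'] /= e0 e'0; exists (s ++ s', Num.min e e').
    by rewrite /= lt_min e0.
  move=> h /= H; split => a aS /=; have := H a;
    rewrite mem_cat aS ?orbT lt_min => /(_ isT) /andP[] //.
have Fg : F --> g.
  apply/cvg_sup => a N; rewrite nbhsE => -[_ [[W oW <-] /= Wg] WN].
  have oW' : open (@circle_pi R @^-1` W) by exact: oW.
  have /nbhs_ballP[e /= e0 eW] : nbhs (lift (g a)) (@circle_pi R @^-1` W).
    by apply: open_nbhs_nbhs; split => //=; rewrite liftK.
  exists ([:: a], e) => // h /= H; apply: WN => /=.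
  rewrite -[X in W X]liftK; apply: (eW (lift (h a))); rewrite /ball/= distrC.
  by apply: H; rewrite inE.
have : nbhs g U by apply: open_nbhs_nbhs.
move=> /Fg [[s e] /= e0 sub]; exists s, e; split => // psi H.
by apply: sub => a aS /=; exact: H.
Qed.

Variable i : A -> nat.
Hypothesis inj_i : injective i.

Lemma measurable_to_dual d (T : measurableType d) (F : T -> X) :
  (forall a, measurable_fun setT (fun t => coord a (F t))) ->
  measurable_fun setT F.
Proof.
move=> mF.
apply: (@measurability _ _ T X setT F (@open (dual_top R A))) => //.
move=> _ [U oU <-]; rewrite setTI.
(* Countably many boxes: [p.1] lists coordinate indices with rational centres, and the common radius
   is the inverse of [p.2.+1]. *)
pose box (p : seq (nat * rat) * nat) := [set psi : X |
  forall a q, (i a, q) \in p.1 -> `|coord a psi - ratr q| < p.2.+1%:R^-1].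
have mbox p : measurable (F @^-1` box p).
  pose B1 (q : nat * rat) := [set psi : X | forall a, i a = q.1 ->
    `|coord a psi - ratr q.2| < p.2.+1%:R^-1].
  rewrite (_ : F @^-1` box p = \bigcap_(q in [set` p.1]) (F @^-1` B1 q)); last first.
    apply/seteqP; split => t /=.
      by move=> H [j q] /= jq a ia; apply: H; rewrite ia.
    by move=> H a q /H /=; exact.
  apply: fin_bigcap_measurable => // -[j q] _; have [[a ia]|na] := pselect (exists a, i a = j); last first.
    rewrite (_ : _ @^-1` _ = setT)//; apply/seteqP; split => // t _ a ia.
    by case: na; exists a.
  pose e : R := p.2.+1%:R^-1; pose I := `](ratr q - e), (ratr q + e)[%classic : set R.
  have := mF a measurableT I (measurable_itv _); rewrite setTI.
  congr measurable; apply/seteqP; split => t; rewrite /I/= in_itv/= -ltr_distl.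
    by move=> H a'; rewrite -ia => /inj_i ->.
  by move=> H; exact: H.
rewrite (_ : F @^-1` U = \bigcup_(p : seq (nat * rat) * nat)
    (if `[< box p `<=` U >] then F @^-1` box p else set0)).
  apply: countable_bigcupT_measurable; first exact: countableP.
  by move=> p; case: ifP.
apply/seteqP; split => t; last by move=> [p _]; case: asboolP => // pO; exact: pO.
move=> /= Ot; have [s [e [e0 sub]]] := dual_open_coord oU Ot.
(* Two points of a box differ by less than twice its radius in each listed coordinate, so the radius
   is chosen below [e / 2]. *)
pose k := Num.truncn (2 / e).
have ke : 2 / k.+1%:R < e.
  by rewrite ltr_pdivrMr// mulrC -ltr_pdivrMr// truncnS_gt.
have k0 : (0 : R) < k.+1%:R^-1 by rewrite invr_gt0.
have /choice[q Hq] : forall a, exists q : rat, `|coord a (F t) - ratr q| < k.+1%:R^-1.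
  move=> a; have /rat_in_itvoo[q] : coord a (F t) - k.+1%:R^-1 < coord a (F t) + k.+1%:R^-1.
    by rewrite ltrD2l gtrN.
  by rewrite in_itv/= -ltr_distl => h; exists q; rewrite distrC.
exists ([seq (i a, q a) | a <- s], k) => //.
case: asboolP => [_ a q' /mapP[a' a's [/inj_i <- ->]]|[]]; first exact: Hq.
move=> psi Hpsi; apply: sub => a aS; apply: lt_trans ke.
have /= H1 := Hpsi a (q a) (map_f _ aS); have H2 := Hq a.
rewrite (_ : _ - _ = (coord a psi - ratr (q a)) - (coord a (F t) - ratr (q a))); last by ring.
apply: le_lt_trans (ler_normB _ _) _.
by rewrite (_ : 2 / _ = k.+1%:R^-1 + k.+1%:R^-1); [exact: ltrD|ring].
Qed.

Lemma coord_add a (chi psi : X) :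
  coord a (chi + psi : pontryagin_dual R A) = frac (coord a chi + coord a psi).
Proof. by rewrite -lift_pi raddfD/= !coord_pi. Qed.

Definition translation_invariant (mu : {measure set X -> \bar R}) :=
  forall (chi : X) (E : set X), measurable E ->
    mu [set psi : X | E (chi + psi : pontryagin_dual R A)] = mu E.

Lemma haar_translation_invariant (mu : probability X R) :
  is_haar mu -> translation_invariant mu.
Proof.
move=> haar chi E mE; rewrite -[RHS](haar (- chi : pontryagin_dual R A) E mE).
congr (mu _); apply/seteqP; split => psi /=.
  move=> H; exists (chi + psi : pontryagin_dual R A) => //.
  by rewrite addrA addNr add0r.
by move=> [psi' H <-]; rewrite addrA subrr add0r.
Qed.

(** The set of pairs with sum in [E] is measured by the product of [mu] and [nu] in both orders of
    integration. Invariance of [nu] gives [nu E] in one order, that of [mu] gives [mu E] in the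
    other. *)
Lemma translation_invariant_unique (mu nu : probability X R) :
  translation_invariant mu -> translation_invariant nu ->
  forall E, measurable E -> mu E = nu E.
Proof.
move=> imu inu E mE.
pose add (p : X * X) : X := (p.1 + p.2 : pontryagin_dual R A).
have madd : measurable_fun setT add.
  apply: measurable_to_dual => a.
  rewrite (_ : (fun p => _) = @frac R \o (fun p : X * X => coord a p.1 + coord a p.2)).
  apply: (@measurableT_comp _ _ _ _ _ _ (@frac R)); first exact: measurable_frac.
  apply: measurable_funD; apply: measurableT_comp => //; exact: measurable_coord.
  by apply/funext => p; rewrite /= -coord_add.
have mS : measurable (add @^-1` E) by rewrite -[X in measurable X]setTI; exact: madd.
have h1 : ((mu \x nu) (add @^-1` E) = nu E)%E.
  rewrite /product_measure1 (eq_integral (fun=> nu E)).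
    by rewrite integral_cst// [X in (_ * X)%E](@probability_setT _ _ _ mu) mule1.
  move=> x _ /=; rewrite -(inu x E mE); congr (nu _).
  by apply/seteqP; split => y; rewrite /xsection /= in_setE.
have h2 : ((mu \x^ nu) (add @^-1` E) = mu E)%E.
  rewrite /product_measure2 (eq_integral (fun=> mu E)).
    by rewrite integral_cst// [X in (_ * X)%E](@probability_setT _ _ _ nu) mule1.
  move=> y _ /=; rewrite -(imu y E mE); congr (mu _).
  by apply/seteqP; split => x; rewrite /ysection /= in_setE /add/= addrC.
rewrite -h1 -h2; apply/esym; apply: product_measure_unique => // B B' mB mB' /=.
by rewrite product_measure2E.
Qed.

End DualBorel.

(** * Characters of Z(G)/Z(G)f *)

Section Countability.
Variable G : groupType.

Let word := seq (bool * nat).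

(** A letter [(b, k)] stands for the [k]-th generator, inverted when [b] holds. *)
Let eval (s : seq G) (w : word) : G :=
  foldr (fun p g => ((if p.1 then (nth 1 s p.2)^-1 else nth 1 s p.2) * g)%g) 1%g w.

Let eval_cat s w w' : eval s (w ++ w') = (eval s w * eval s w')%g.
Proof. by elim: w => [|p w IH] /=; rewrite ?mul1g// IH mulgA. Qed.

Let eval_inv s w : exists w', eval s w' = ((eval s w)^-1)%g.
Proof.
elim: w => [|[b k] w [w' IH]] /=; first by exists [::]; rewrite invg1.
exists (w' ++ [:: (~~ b, k)]); rewrite eval_cat IH/= mulg1 invgM.
by case: b => /=; rewrite ?invgK.
Qed.

(** The values of words form a subgroup containing the generators, and there are countably many
    words. *)
Lemma finitely_generated_countable : finitely_generated G ->
  exists i : G -> nat, injective i.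
Proof.
move=> [S [finS genS]]; pose s : seq G := fset_set S.
have evalT : range (eval s) = setT.
  apply: genS.
  - move=> g Sg; exists [:: (false, index g s)] => //=.
    by rewrite mulg1 nth_index// in_fset_set// mem_set.
  - by exists [::].
  - by move=> _ _ [w _ <-] [w' _ <-]; exists (w ++ w') => //; rewrite eval_cat.
  - by move=> _ [w _ <-]; have [w' <-] := eval_inv s w; exists w'.
have /choice[c cP] : forall g, exists w, eval s w = g.
  by move=> g; have : range (eval s) g; [rewrite evalT|move=> [w _ <-]; exists w].
by exists (choice.pickle \o c); apply: inj_comp (pcan_inj choice.pickleK) (can_inj cP).
Qed.

Lemma groupring_countable (i : G -> nat) : injective i ->
  exists j : groupring G -> nat, injective j.
Proof.
move=> inj_i; pose c (x : groupring G) : seq (nat * int) :=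
  [seq (i g, gr_coef x g) | g <- gr_supp x].
exists (choice.pickle \o c); apply: inj_comp (pcan_inj choice.pickleK) _ => x y xy.
have mem z g : ((i g, gr_coef z g) \in c z) = (g \in gr_supp z).
  apply/mapP/idP => [[h hz [/inj_i -> _]] //|gz]; by exists g.
have coefE z z' g : c z = c z' -> g \in gr_supp z -> gr_coef z g = gr_coef z' g.
  by move=> e; rewrite -mem e => /mapP[h _ [/inj_i <- ->]].
apply: gr_ext => g; have [gx|gx] := boolP (g \in gr_supp x); first exact: coefE.
have [gy|gy] := boolP (g \in gr_supp y); first by rewrite (coefE _ _ _ (esym xy) gy).
by rewrite !gr_coef_out.
Qed.

End Countability.

(** * Additive extension of functions on G to Z(G) *)

Section Evaluation.
Variables (R : realType) (G : groupType).
Implicit Types (y : G -> R) (h x : groupring G).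

Definition ev y h : R := \sum_(g <- gr_supp h) y g *~ gr_coef h g.

Lemma evEw y h (D : {fset G}) : (gr_supp h `<=` D)%fset ->
  ev y h = \sum_(g <- D) y g *~ gr_coef h g.
Proof. by move=> hD; apply: big_fset_incl => // g _ /gr_coef_out ->. Qed.

Lemma evB y : zmod_morphism (ev y).
Proof.
move=> h x; pose D := (gr_supp h `|` gr_supp x)%fset.
rewrite (@evEw _ _ D); last first.
  apply/fsubsetP => g; apply: contraLR; rewrite in_fsetU negb_or => /andP[gh gx].
  by rewrite memNfinsupp -[X in X == _]/(gr_coef _ _) gr_coefD gr_coefN !gr_coef_out.
rewrite (@evEw _ h D) ?fsubsetUl// (@evEw _ x D) ?fsubsetUr// -sumrB.
by apply: eq_bigr => g _; rewrite gr_coefD gr_coefN mulrzBr.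
Qed.

HB.instance Definition _ y := GRing.isZmodMorphism.Build (groupring G) R (ev y) (evB y).

Lemma ev_elt y g : ev y (gr_elt g) = y g.
Proof. by rewrite (evEw _ (gr_supp_elt g)) big_seq_fset1 gr_eltE eqxx. Qed.

Lemma gr_coef_sum (I : Type) (r : seq I) (F : I -> groupring G) k :
  gr_coef (\sum_(i <- r) F i) k = \sum_(i <- r) gr_coef (F i) k.
Proof. by elim/big_rec2: _ => [|i u v _ <-]; rewrite ?gr_coef0 ?gr_coefD. Qed.

Lemma gr_coefMz h (z : int) k : gr_coef (h *~ z) k = gr_coef h k *~ z.
Proof.
have Mn n : gr_coef (h *+ n) k = gr_coef h k *+ n.
  by elim: n => [|n IH]; rewrite ?mulr0n ?gr_coef0// !mulrS gr_coefD IH.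
by case: (intP z) => [|n|n]; rewrite ?mulrNz -?pmulrn ?gr_coefN Mn.
Qed.

Lemma gr_decomp h : h = \sum_(g <- gr_supp h) gr_elt g *~ gr_coef h g.
Proof.
apply: gr_ext => k; rewrite gr_coef_sum.
under eq_bigr => g _ do rewrite gr_coefMz gr_eltE.
have [kh|kh] := boolP (k \in gr_supp h).
  rewrite (big_fsetD1 k)//= eqxx big_seq big1 ?addr0 ?intz// => g.
  by rewrite in_fsetD1 => /andP[/negPf gk _]; rewrite eq_sym gk mul0rz.
rewrite gr_coef_out// big_seq big1// => g gh.
by case: eqP kh => [->|]; rewrite ?gh ?mul0rz.
Qed.

Lemma gr_elt_mul (g k : G) : gr_elt g * gr_elt k = gr_elt (g * k)%g.
Proof.
apply: gr_ext => u; rewrite [LHS]gr_mul_eltl !gr_eltE; congr (_%:R); congr nat_of_bool.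
apply/eqP/eqP => [<-|->]; first by rewrite mulVKg.
by rewrite mulKg.
Qed.

Lemma ev_translate y g h : ev y (gr_elt g * h) = ev (fun k => y (g * k)%g) h.
Proof.
rewrite [in LHS](gr_decomp h) mulr_sumr raddf_sum/=; apply: eq_bigr => k _.
by rewrite mulrzAr raddfMz/= gr_elt_mul ev_elt.
Qed.

Lemma ev_int (c : G -> int) h : ev (fun g => (c g)%:~R) h \is a Num.int.
Proof. by rewrite rpred_sum// => g _; rewrite rpredMz// intr_int. Qed.

Lemma ev_lin y y' h : ev (fun g => y g + y' g) h = ev y h + ev y' h.
Proof. by rewrite -big_split; apply: eq_bigr => g _; rewrite mulrzDl. Qed.

End Evaluation.

Section Character.
Variables (R : realType) (G : groupType) (f : groupring G).
Local Open Scope quotient_scope.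
Local Notation Q := (Quotient.quot (lideal_zmodClosed f)).

Definition lpi (h : groupring G) : lquot f := \pi_Q h.

Lemma lpi_eq h h' : lpi h = lpi h' <-> exists k, h - h' = k * f.
Proof.
rewrite /lpi; split.
  by move/eqP; rewrite -Quotient.idealrBE => /lidealP.
by move=> e; apply/eqP; rewrite -Quotient.idealrBE; apply/lidealP.
Qed.

Lemma lpi_surj (a : lquot f) : lpi (repr (a : Q)) = a.
Proof. exact: reprK. Qed.

Lemma lpiB : zmod_morphism lpi.
Proof. exact: (raddfB \pi_Q). Qed.

HB.instance Definition _ := GRing.isZmodMorphism.Build (groupring G) (lquot f) lpi lpiB.

(** The condition that [y] modulo 1 kills the left ideal; the elements [gr_elt g * f] suffice
    because they generate it additively. *)
Definition integral_on (y : G -> R) :=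
  forall g, ev y (gr_elt g * f) \is a Num.int.

Lemma integral_on_mul y k : integral_on y -> ev y (k * f) \is a Num.int.
Proof.
move=> yi; rewrite (gr_decomp k) mulr_suml raddf_sum/= rpred_sum// => g _.
by rewrite mulrzAl raddfMz/= rpredMz// yi.
Qed.

Definition character_fun (y : G -> R) (a : lquot f) : circle R :=
  @circle_pi R (ev y (repr (a : Q))).

Lemma character_fun_pi y h : integral_on y ->
  character_fun y (lpi h) = @circle_pi R (ev y h).
Proof.
move=> yi; apply/circle_pi_eq; rewrite -raddfB/=.
have /lpi_eq[k ->] : lpi (repr (lpi h : Q)) = lpi h := lpi_surj _.
exact: integral_on_mul.
Qed.

Lemma character_funB y : integral_on y -> zmod_morphism (character_fun y).
Proof.
move=> yi a b; rewrite -[a]lpi_surj -[b]lpi_surj -raddfB/=.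
by rewrite !character_fun_pi// !raddfB.
Qed.

Definition character (y : G -> R) (yi : integral_on y) : Xf R f :=
  HB.pack_for {additive lquot f -> circle R} (character_fun y)
    (GRing.isZmodMorphism.Build (lquot f) (circle R) (character_fun y) (character_funB yi)).

Lemma characterE y (yi : integral_on y) h :
  dual_fun (character yi) (lpi h) = @circle_pi R (ev y h).
Proof. exact: character_fun_pi. Qed.

Lemma character_ext (chi psi : Xf R f) :
  (forall h, dual_fun chi (lpi h) = dual_fun psi (lpi h)) -> chi = psi.
Proof. by move=> e; apply: dual_ext => a; rewrite -[a]lpi_surj e. Qed.

(** A homomorphism is determined by its values on group elements; [y] collects their representatives
    in [[0, 1)], and vanishing on the ideal becomes integrality. *)
Lemma character_exists (chi : Xf R f) : exists (y : G -> R) (yi : integral_on y),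
  (forall g, 0 <= y g < 1) /\ chi = character yi.
Proof.
pose y g := lift (dual_fun chi (lpi (gr_elt g))).
pose u : {additive lquot f -> circle R} := chi.
have yE h : @circle_pi R (ev y h) = u (lpi h).
  rewrite [in RHS](gr_decomp h) !raddf_sum/=; apply: eq_bigr => g _.
  by rewrite !raddfMz/= liftK.
have yi : integral_on y.
  move=> g; have f0 : lpi (gr_elt g * f) = 0.
    by rewrite -(raddf0 lpi); apply/lpi_eq; exists (gr_elt g); rewrite subr0.
  have : @circle_pi R (ev y (gr_elt g * f)) = @circle_pi R 0 by rewrite yE f0 !raddf0.
  by move/circle_pi_eq; rewrite subr0.
exists y, yi; split; first by move=> g; rewrite lift_ge0 lift_lt1.
by apply: character_ext => h; rewrite characterE yE.
Qed.

End Character.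

(** * The symbolic cover *)

Lemma measure_le_off_negligible d (T : measurableType d) (R : realType)
    (mu : {measure set T -> \bar R}) (A B N : set T) :
  measurable A -> measurable B -> mu.-negligible N -> A `\` N `<=` B ->
  (mu A <= mu B)%E.
Proof.
move=> mA mB [N' [mN' N'0 NN']] AB.
have -> : mu B = (mu B + mu N')%E by rewrite [X in (_ + X)%E]N'0 adde0.
apply: (@le_trans _ _ (mu (B `|` N'))); last exact: measureU2.
apply: le_measure; rewrite ?inE//; first exact: measurableU.
by move=> t At; have [Nt|Nt] := pselect (N t); [right; exact: NN'|left; exact: AB].
Qed.

Section SymbolicCover.
Variables (R : realType) (G : groupType) (lt : rel G).
Hypothesis ltP : left_invariant_order lt.
Variables (ss : seq G) (al : G -> int) (n : nat).
Hypothesis ss_gt1 : forall s, s \in ss -> lt 1%g s.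
Hypothesis alM : \sum_(s <- ss) `|al s| < n.+1%:Z.
Variable zeta : probability (shift_space G (digit n)) R.
Hypothesis zetaP : is_product_measure (@uniform_digit R n) zeta.
Variables (i : G -> nat) (f : groupring G) (sg : int).
Hypothesis inj_i : injective i.
Hypothesis sg1 : sg * sg = 1.
Hypothesis fE : forall (y : G -> R) g,
  ev y (gr_elt g * f) = sg%:~R * (n.+1%:R * y g + shift_sum ss al y g).

Local Notation W := (shift_space G (digit n)).
Local Notation Sol := (sol ss al n).

Definition digits (b : W) (g : G) : R := (b g : nat)%:R.

Lemma digits_le b g : `|digits b g| <= n%:R.
Proof. by rewrite ger0_norm// ler_nat -ltnS ltn_ord. Qed.

Lemma sol_digits_integral b : integral_on f (Sol (digits b)).
Proof.
move=> g; rewrite fE (sol_eq alM (digits_le b)).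
by rewrite /digits pmulrn rpredM ?intr_int.
Qed.

Definition cover (b : W) : Xf R f := character (sol_digits_integral b).

Lemma coverE b h : dual_fun (cover b) (lpi f h) = @circle_pi R (ev (Sol (digits b)) h).
Proof. exact: characterE. Qed.

Lemma quotient_countable : exists j : lquot f -> nat, injective j.
Proof.
have [j inj_j] := groupring_countable inj_i.
exists (j \o (fun a : lquot f => repr (a : Quotient.quot (lideal_zmodClosed f)))).
by apply: inj_comp inj_j _ => a b ab; rewrite -[a]lpi_surj ab lpi_surj.
Qed.

Lemma measurable_cover : measurable_fun setT cover.
Proof.
have [j inj_j] := quotient_countable.
apply: (measurable_to_dual inj_j) => a; rewrite -[a]lpi_surj.
set h := repr _.
rewrite (_ : (fun b => _) = @frac R \o (fun b => ev (Sol (digits b)) h)); last first.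
  by apply/funext => b; rewrite /= -lift_pi -coverE.
apply: (@measurableT_comp _ _ _ _ _ _ (@frac R)); first exact: measurable_frac.
apply: measurable_sum => g.
rewrite (_ : (fun b => _) = (fun b => Sol (digits b) g * (gr_coef h g)%:~R)); last first.
  by apply/funext => b; rewrite mulrzr.
apply: measurable_funM => //.
apply: (measurable_sol alM digits_le) => k; rewrite /digits.
have mk : preim_measurable (fun b : W => b k).
  by move=> Y; have := @measurable_coordinate G _ (digit n) k measurableT Y; rewrite setTI; exact.
exact: (preim_measurable_fun (fun j : digit n => (j : nat)%:R : R) mk).
Qed.

(** [shift_sum] multiplies on the right and so commutes with left translation: the translated
    solution solves the translated equation, and bounded solutions are unique. *)
Lemma cover_equivariant g b :
  cover (@bernoulli_shift G _ (digit n) g b) = Xf_act g (cover b).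
Proof.
apply: character_ext => h; rewrite coverE.
transitivity (dual_fun (cover b) (lquot_mul (g^-1)%g (lpi f h))) => //.
rewrite /lpi lquot_mul_pi -/(lpi f _) coverE ev_translate.
congr (circle_pi (ev _ h)); apply/esym.
apply: (sol_unique alM (digits_le _) (C := n%:R)) => k.
  exact: (sol_le alM (digits_le b)).
rewrite -[RHS](sol_eq alM (digits_le b) (g^-1 * k)%g); congr (_ + _).
by apply: eq_bigr => s _; rewrite mulgA.
Qed.

Lemma bounded_integral_coef (y : G -> R) : integral_on f y ->
  (forall g, 0 <= y g < 1) -> exists w : G -> int,
  (forall g, (w g)%:~R = n.+1%:R * y g + shift_sum ss al y g) /\
  (forall g, `|w g| <= (2 * n.+1)%:Z).
Proof.
move=> yi y01.
have /choice[w wE] : forall g, exists z : int,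
    z%:~R = n.+1%:R * y g + shift_sum ss al y g.
  move=> g; have /intrP[z zE] := yi g; exists (sg * z).
  by rewrite rmorphM/= -zE fE mulrA -rmorphM/= sg1 mul1r.
exists w; split => // g; rewrite -(ler_int R) intr_norm wE.
have y1 h : `|y h| <= 1 by have /andP[y0 /ltW] := y01 h; rewrite ger0_norm.
apply: le_trans (ler_normD _ _) _.
(* One [n.+1] bounds the term [n.+1%:R * y g], the other bounds the shift sum. *)
rewrite mul2n -addnn PoszD rmorphD/=; apply: lerD.
  by rewrite normrM (ger0_norm (ler0n R n.+1)) ler_piMr.
apply: le_trans (@shift_sum_le R G ss al n y 1 y1 g) _; rewrite mulr1.
by rewrite ler_piMr// ltW// rho_lt1.
Qed.

(** Here [chi] is the image of [w] under xi. Subtracting the integer carries from the sum of the two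
    solutions leaves a bounded solution for the new digits, and integers vanish modulo 1. *)
Lemma cover_carry_map (chi : Xf R f) : exists (w : G -> int) (K : int),
  (forall g, `|w g| + n%:Z <= K) /\
  forall b : W, carry_good ss al n.+1 (translate w b) K ->
    cover (carry_map ss al w K b) = (chi + cover b : pontryagin_dual R (lquot f)).
Proof.
have [y [yi [y01 ->]]] := character_exists chi.
have [w [wE wle]] := bounded_integral_coef yi y01.
exists w, ((2 * n.+1)%:Z + n%:Z); split => [g|b good]; first by rewrite lerD2r.
set K := (_ + _) in good *.
have wK g : `|w g| + n%:Z <= K by rewrite lerD2r.
pose c := carry_at ss al w K b.
have solE : (fun g => (y g + Sol (digits b) g) - (c g)%:~R) =
    Sol (digits (carry_map ss al w K b)).
  (* The bound adds 1 for [y], [n] for the solution of [b] and [K] for the carries. *)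
  apply: (sol_unique alM (digits_le _) (C := 1 + n%:R + K%:~R)) => g.
    apply: le_trans (ler_normB _ _) _; apply: lerD; last first.
      by rewrite -intr_norm ler_int; apply: carry_le => //; exact: translate_le.
    apply: le_trans (ler_normD _ _) _; apply: lerD.
      by have /andP[y0 /ltW] := y01 g; rewrite ger0_norm.
    exact: (sol_le alM (digits_le b)).
  rewrite shift_sumB shift_sumD shift_sum_intr /digits.
  rewrite -[RHS]/(((carry_map ss al w K b g : nat)%:Z)%:~R).
  rewrite (carry_map_eq alM wK g good) !rmorphB rmorphM /translate rmorphD/= wE.
  rewrite -/c -[(b g : nat)%:~R]/(digits b g) -(sol_eq alM (digits_le b) g).
  ring.
apply: character_ext => h; rewrite coverE.
transitivity (@circle_pi R (ev y h) + @circle_pi R (ev (Sol (digits b)) h)); last first.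
  by rewrite -coverE -(characterE yi).
rewrite -raddfD/=; apply/circle_pi_eq; rewrite -solE.
rewrite -ev_lin -opprB rpredN.
rewrite (_ : _ - _ = ev (fun g => (c g)%:~R) h); first exact: ev_int.
rewrite /ev -sumrB; apply: eq_bigr => g _; rewrite -mulrzBl; congr (_ *~ _).
ring.
Qed.

Let nu := pushforward_probability zeta measurable_cover.

Lemma measurable_translation (chi : Xf R f) :
  measurable_fun setT (fun psi : Xf R f => (chi + psi : pontryagin_dual R (lquot f)) : Xf R f).
Proof.
have [j inj_j] := quotient_countable.
apply: (measurable_to_dual inj_j) => a.
rewrite (_ : (fun psi => _) = @frac R \o (fun psi => coord a chi + coord a psi)).
  apply: (@measurableT_comp _ _ _ _ _ _ (@frac R)); first exact: measurable_frac.
  by apply: measurable_funD => //; exact: measurable_coord.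
by apply/funext => psi; rewrite /= -coord_add.
Qed.

(** Off a null set, [chi + cover b] lies in [E] exactly when [cover] of the carried configuration
    does, and [carry_map] preserves [zeta]. *)
Lemma cover_translation_invariant : translation_invariant nu.
Proof.
move=> chi E mE; have [w [K [wK ceq]]] := cover_carry_map chi.
have mcov F : measurable F -> measurable (cover @^-1` F).
  by move=> mF; rewrite -[X in measurable X]setTI; exact: measurable_cover.
pose E' : set (Xf R f) := [set psi : Xf R f | E (chi + psi : pontryagin_dual R (lquot f))].
have mE' : measurable E'.
  by have := measurable_translation chi measurableT mE; rewrite setTI.
have negl := carry_good_ae ltP ss_gt1 alM wK zetaP inj_i.
have mc : measurable (carry_map ss al w K @^-1` (cover @^-1` E)).
  rewrite -[X in measurable X]setTI; apply: measurable_carry_map => //.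
  exact: mcov.
rewrite -[LHS]/(zeta (cover @^-1` E')) -[RHS]/(zeta (cover @^-1` E)).
rewrite -[RHS](carry_map_preserves ltP ss_gt1 alM wK zetaP (mcov _ mE)).
apply/eqP; rewrite eq_le; apply/andP; split.
  apply: (measure_le_off_negligible _ _ negl) => //; first exact: mcov.
  by move=> b [Eb /contrapT good]; rewrite /= ceq.
apply: (measure_le_off_negligible _ _ negl) => //; first exact: mcov.
by move=> b [Eb /contrapT good]; move: Eb; rewrite /= ceq.
Qed.

Lemma cover_factor_map (mu : probability (Xf R f) R) : is_haar mu ->
  factor_map (@bernoulli_shift G _ (digit n)) zeta (@Xf_act R G f) mu cover.
Proof.
move=> haar; have [j inj_j] := quotient_countable; split.
- exact: measurable_cover.
- by apply: aeW => b g; exact: cover_equivariant.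
- move=> E mE; rewrite -[LHS]/(nu E); apply: (translation_invariant_unique inj_j) => //.
    exact: cover_translation_invariant.
  exact: haar_translation_invariant.
Qed.

Lemma cover_injective_ae : exists2 N : set W, zeta.-negligible N &
  forall b b', ~ N b -> ~ N b' -> cover b = cover b' -> b = b'.
Proof.
(* Each solution is bounded by the largest digit [n], so an integer difference of two solutions is
   bounded by [n + n]. *)
pose K : int := n%:Z + n%:Z.
have wK (g : G) : `|0 : int| + n%:Z <= K by rewrite normr0 lerD2r.
exists (~` [set b : W | carry_good ss al n.+1 (translate (fun=> 0) b) K]).
  exact: (carry_good_ae ltP ss_gt1 alM wK zetaP inj_i).
move=> b b' /contrapT good _ bb'.
pose d g := Sol (digits b) g - Sol (digits b') g.
have dint g : d g \is a Num.int.
  by apply/circle_pi_eq; rewrite -(ev_elt (Sol (digits b))) -(ev_elt (Sol (digits b')))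
    -!coverE bb'.
have /choice[c cE] : forall g, exists z : int, d g = z%:~R.
  by move=> g; have /intrP := dint g.
(* Applying the operator to the integer difference [c] returns the difference of the digits. Hence
   [c] is a carry for [b] with remainder [b'], while [0] is a carry for [b] with remainder [b];
   uniqueness makes them equal. *)
have ceq g : (b g : nat)%:Z - (b' g : nat)%:Z = n.+1%:Z * c g + shift_sum ss al c g.
  apply/eqP; rewrite -(eqr_int R); apply/eqP.
  rewrite rmorphB rmorphD rmorphM/= -shift_sum_intr -(funext cE) -cE /d shift_sumB.
  rewrite -[X in X - _ = _]/(digits b g) -[X in _ - X = _]/(digits b' g).
  rewrite -(sol_eq alM (digits_le b)) -(sol_eq alM (digits_le b')).
  ring.
have cK g : `|c g| <= K.
  rewrite -(ler_int R) intr_norm -cE; apply: le_trans (ler_normB _ _) _.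
  by rewrite rmorphD/=; apply: lerD; exact: (sol_le alM (digits_le _)).
have small (x : W) g : divz (x g : nat)%:Z n.+1 = 0.
  by rewrite divz_small//= ltz_nat ltn_ord.
have uniq := carry_unique (ltn0Sn n) alM (translate_le wK b) good.
have zero_carry : is_carry ss al n.+1 (translate (fun=> 0) b) (fun=> 0).
  move=> g; rewrite /translate addr0 /shift_sum big1 ?subr0 ?small// => s _.
  by rewrite mul0rz.
have zero_le (g : G) : `|0 : int| <= K.
  by rewrite normr0; exact: le_trans (normr_ge0 _) (cK g).
have c_carry : is_carry ss al n.+1 (translate (fun=> 0) b) c.
  move=> g; rewrite /translate addr0 (_ : _ - _ = c g * n.+1%:Z + (b' g : nat)%:Z).
    by rewrite divzMDl// small addr0.
  by have /eqP := ceq g; rewrite subr_eq => /eqP ->; ring.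
have c0 : c = (fun=> 0).
  exact: etrans (uniq c c_carry cK) (esym (uniq _ zero_carry zero_le)).
apply/funext => g; apply: val_inj; apply/eqP; rewrite -eqz_nat -subr_eq0 ceq c0.
by rewrite mulr0 /shift_sum big1 ?addr0// => s _; rewrite mul0rz.
Qed.

End SymbolicCover.

(** * Finite support, sign normalisation and conclusion *)

Lemma fsum_fset_set (V : nmodType) (T : choiceType) (S P : set T) (F : T -> V) :
  P `<=` S -> finite_set P -> (forall s, S s -> ~ P s -> F s = 0) ->
  \sum_(s \in S) F s = \sum_(s <- fset_set P) F s.
Proof.
move=> PS finP F0; rewrite -fsbig_finite//; apply/esym.
by apply: fsbig_widen => // s [Ss /(F0 _ Ss)].
Qed.

Theorem theorem1p2 (R : realType) (G : groupType) (lt : rel G) (S : set G)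
    (m : int) (a : G -> int) (f : groupring G) :
  finitely_generated G ->
  left_invariant_order lt ->
  S `<=` [set g | lt 1%g g] ->
  generates S ->
  (exists s t, [/\ S s, S t & s != t]) ->
  finite_set [set s | S s /\ a s != 0] ->
  f = m%:~R + \sum_(s \in S) gr_elt s *~ a s ->
  \sum_(s \in S) `|a s| < `|m| ->
  forall mu : probability (Xf R f) R, is_haar mu ->
    (exists (d : measure_display) (B : measurableType d)
        (beta : probability B R) (zeta : probability (shift_space G B) R),
      [/\ standard_borel R B, is_product_measure beta zeta &
          is_factor (@bernoulli_shift G d B) zeta (@Xf_act R G f) mu]) /\
    (amenable G ->
      exists (d : measure_display) (B : measurableType d)
        (beta : probability B R) (zeta : probability (shift_space G B) R),
      [/\ standard_borel R B, is_product_measure beta zeta,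
          isomorphic_actions (@bernoulli_shift G d B) zeta (@Xf_act R G f) mu &
          shannon_entropy beta = (ln `|m|%:~R)%:E]).
Proof.
move=> fgG ltP Sgt1 _ _ finP fE am mu haar.
pose P := [set s | S s /\ a s != 0].
have PS : P `<=` S by move=> s [].
have aP s : S s -> ~ P s -> a s = 0.
  by move=> Ss nP; apply/eqP/negPn/negP => as0; apply: nP.
pose ss : seq G := fset_set P; pose n := `|m|%N.-1.
(* Multiplying by the sign of [m] makes the constant term positive; it is undone in [evE] because
   [sg * sg = 1]. *)
pose sg : int := if 0 <= m then 1 else -1; pose al s := sg * a s.
have sg1 : sg * sg = 1 by rewrite /sg; case: ifP.
have ss_gt1 s : s \in ss -> lt 1%g s.
  by rewrite in_fset_set// => /set_mem[/Sgt1].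
have sumE : \sum_(s \in S) `|a s| = \sum_(s <- ss) `|al s|.
  rewrite (fsum_fset_set PS)// => [|s Ss nP]; last by rewrite aP// normr0.
  by apply: eq_bigr => s _; rewrite normrM /sg; case: ifP; rewrite ?normrN normr1 mul1r.
(* [m] is nonzero, since a sum of absolute values is strictly below [|m|]; so the predecessor in [n]
   is genuine and [digit n] has [|m|] elements. *)
have nE : n.+1%:Z = `|m|.
  rewrite /n prednK ?abszE// -ltz_nat abszE.
  by apply: le_lt_trans am; rewrite sumE sumr_ge0.
have alM : \sum_(s <- ss) `|al s| < n.+1%:Z by rewrite nE -sumE.
have sgm : m = n.+1%:Z * sg.
  rewrite nE /sg; case: (leP 0 m) => h /=.
    by rewrite ger0_norm// mulr1.
  by rewrite ltr0_norm// mulrN1 opprK.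
have evE (y : G -> R) g :
    ev y (gr_elt g * f) = sg%:~R * (n.+1%:R * y g + shift_sum ss al y g).
  rewrite fE mulrDr mulrzr (fsum_fset_set PS)//; last first.
    by move=> s Ss nP; rewrite aP.
  rewrite mulr_sumr raddfD raddf_sum raddfMz/= ev_elt mulrDr; congr (_ + _).
    by rewrite {1}sgm -mulrzr rmorphM/= -[(n.+1%:Z)%:~R]/(n.+1%:R); ring.
  rewrite /shift_sum mulr_sumr; apply: eq_bigr => s _.
  have -> : gr_elt g * (gr_elt s *~ a s) = gr_elt (g * s)%g *~ a s.
    by rewrite mulrzAr gr_elt_mul.
  by rewrite raddfMz/= ev_elt /al mulrzA mulrzAr mulrzl -mulrzA sg1.
have [i inj_i] := finitely_generated_countable fgG.
have [zeta zetaP] := @exists_product_measure R G n i inj_i.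
have fac := cover_factor_map ltP ss_gt1 alM zetaP inj_i sg1 evE haar.
have inj := cover_injective_ae ltP ss_gt1 alM zetaP inj_i evE.
split; last first => [_|];
  exists default_measure_display, (digit n), (@uniform_digit R n), zeta.
  split => //; first exact: digit_standard_borel.
    by eexists; [exact: fac|exact: inj].
  by rewrite uniform_digit_entropy -nE.
by split => //; [exact: digit_standard_borel|eexists; exact: fac].
Qed.
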